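(* The Hopf algebra $\mathbf{Baxter}$ is free (as an algebra) on the elements $\mathbf{E}_J$ where $J$ is a nonempty connected pair of twin binary trees.
   Context: The ground field $\mathbb{K}$ has characteristic zero. $\mathfrak{S} = \bigcup_{n\ge 0}\mathfrak{S}_n$ is the set of all permutations, seen as words. The shifted shuffle $\sigma \mathbin{\overline{\sqcup\!\sqcup}} \nu$ of permutations $\sigma,\nu$ is the set (formal sum) of all shuffles of the word $\sigma$ with the word obtained from $\nu$ by adding $|\sigma|$ to each letter. $\mathbf{FQSym}$ is the Hopf algebra with basis $\{\mathbf{F}_\sigma\}_{\sigma\in\mathfrak{S}}$ and product $\mathbf{F}_\sigma\cdot\mathbf{F}_\nu = \sum_{\pi\in\sigma\,\overline{\sqcup\!\sqcup}\,\nu}\mathbf{F}_\pi$ (its coproduct is deconcatenation followed by standardization of both factors). The permutohedron order $\leq_{\mathrm{P}}$ on $\mathfrak{S}_n$ is the partial order in which $\sigma$ is covered by $\nu$ if $\sigma = u\,a\,b\,v$ and $\nu = u\,b\,a\,v$ with letters $a < b$. Binary trees are planar; each internal node (called node) has a left and a right child, possibly a leaf; $\perp$ is the empty tree. The canopy $\mathrm{cnp}(T)$ of a binary tree $T$ is the word on $\{0,1\}$ obtained by reading the leaves of $T$ from left to right, omitting the first and the last one, writing $0$ if the leaf is oriented to the right (is the right child of its parent) and $1$ otherwise. A pair of twin binary trees is a pair $(T_L,T_R)$ of binary trees with the same number $n$ of nodes such that $\mathrm{cnp}(T_L)_i \neq \mathrm{cnp}(T_R)_i$ for all $1 \leq i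 \leq n-1$; it is nonempty if $n\geq 1$. $\mathcal{TBT}_n$ is the set of these pairs, and $\mathcal{TBT}=\bigcup_{n\ge0}\mathcal{TBT}_n$. For a permutation $\sigma$, $\mathbb{P}(\sigma) = (T_L, T_R) \in \mathcal{TBT}$ is the pair of unlabeled trees obtained as follows. Start with $(\perp,\perp)$ and insert the letters of $\sigma$ from left to right, inserting each letter $a$ by a leaf insertion in $T_L$ and a root insertion in $T_R$; at the end forget the labels. Leaf insertion of $a$ in a labeled tree: if the tree is empty the result is the one-node tree labeled $a$; otherwise, if $a$ is smaller than the root's label, leaf-insert $a$ in the left subtree, else in the right subtree. Root insertion of $a$ in a binary search tree $T$: the result has a root labeled $a$, left subtree $T_{\leq a}$ and right subtree $T_{>a}$, where $T_{\leq a}$ (resp. $T_{>a}$) is the binary search tree on exactly the nodes of $T$ with label $\leq a$ (resp. $>a$) such that if $x$ is an ancestor of $y$ in it, then $x$ is an ancestor of $y$ in $T$. The partial order $\leq_{\mathrm{B}}$ on $\mathcal{TBT}_n$: $J_0 \leq_{\mathrm{B}} J_1$ if there exist $\sigma_0,\sigma_1\in\mathfrak{S}_n$ with $\mathbb{P}(\sigma_0)=J_0$, $\mathbb{P}(\sigma_1)=J_1$, $\sigma_0\leq_{\mathrm{P}}\sigma_1$. $\mathbf{Baxter}$ is the Hopf subalgebra of $\mathbf{FQSym}$ with basis $\mathbf{P}_J = \sum_{\sigma\in\mathfrak{S},\,\mathbb{P}(\sigma)=J}\mathbf{F}_\sigma$, $J\in\mathcal{TBT}$, and $\mathbf{E}_J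 := \sum_{J \leq_{\mathrm{B}} J'}\mathbf{P}_{J'}$. A Baxter permutation is a permutation $\sigma$ such that no subword $u_1u_2u_3u_4$ of $\sigma$ with $u_2,u_3$ adjacent in $\sigma$ is order-isomorphic to $2413$ or $3142$. For each $J\in\mathcal{TBT}$ there is exactly one Baxter permutation $\sigma$ with $\mathbb{P}(\sigma)=J$. For permutations $\nu,\pi$, $\nu / \pi$ is the concatenation of $\nu$ with the letters of $\pi$ incremented by $|\nu|$. A permutation $\sigma$ is connected if $\sigma=\nu / \pi$ implies $\nu=\sigma$ or $\pi=\sigma$. The pair $J$ is connected if the unique Baxter permutation $\sigma$ with $\mathbb{P}(\sigma)=J$ is connected. *)

(* Defs.v *)
From HB Require Import structures.
From Stdlib Require Import Relation_Operators.
From mathcomp Require Import all_boot all_order all_algebra.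
From mathcomp Require Import finmap.
From mathcomp Require Import boolp classical_sets functions cardinality fsbigop.
From mathcomp Require Import monalg.

Set Implicit Arguments.
Unset Strict Implicit.
Unset Printing Implicit Defensive.

Import GRing.Theory.
Local Open Scope ring_scope.

Record perm_word : predArgType :=
  PermWord { word :> seq nat; _ : perm_eq word (iota 1 (size word)) }.

HB.instance Definition _ := [isSub for word].
HB.instance Definition _ := [Countable of perm_word by <:].

Definition shift (n : nat) (s : seq nat) : seq nat := [seq (n + x)%N | x <- s].

Fixpoint shuffle (s : seq nat) : seq nat -> seq (seq nat) :=
  if s is x :: s' then
    fix shuffle_s (t : seq nat) : seq (seq nat) :=
      if t is y :: t' then
        [seq x :: w | w <- shuffle s' t] ++ [seq y :: w | w <- shuffle_s t']
      else [:: s]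
  else fun t => [:: t].

(* [insub] discards nothing here, see [val_sshuffle] *)
Definition sshuffle (s t : perm_word) : seq perm_word :=
  pmap insub (shuffle s (shift (size s) t)).

Definition perm_cover (s t : perm_word) : Prop :=
  exists (u v : seq nat) (a b : nat),
    [/\ (a < b)%N, s = u ++ [:: a, b & v] :> seq nat
      & t = u ++ [:: b, a & v] :> seq nat].

Definition perm_le : perm_word -> perm_word -> Prop :=
  clos_refl_trans perm_word perm_cover.

Definition is_over (s nu pi : perm_word) : Prop :=
  s = nu ++ shift (size nu) pi :> seq nat.

Definition perm_connected (s : perm_word) : Prop :=
  forall nu pi : perm_word, is_over s nu pi -> nu = s \/ pi = s.

(* [c < a < d < b] says that [abcd] is order-isomorphic to 2413, and
   [b < d < a < c] that it is order-isomorphic to 3142. *)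
Definition is_baxter (s : perm_word) : Prop :=
  forall (t u v w : seq nat) (a b c d : nat),
    s = t ++ a :: u ++ [:: b, c & v] ++ d :: w :> seq nat ->
    ~~ [&& c < a, a < d & d < b]%N /\ ~~ [&& b < d, d < a & a < c]%N.

Inductive tree (T : Type) : Type :=
| Leaf
| Node of tree T & T & tree T.

Arguments Leaf {T}.
Arguments Node {T} _ _ _.

Section TreeChoice.
Variable T : Type.

Fixpoint tree_encode (t : tree T) : GenTree.tree T :=
  if t is Node l x r then
    GenTree.Node 1 [:: tree_encode l; GenTree.Leaf x; tree_encode r]
  else GenTree.Node 0 [::].

Fixpoint tree_decode (t : GenTree.tree T) : option (tree T) :=
  match t with
  | GenTree.Node 0 [::] => Some Leaf
  | GenTree.Node 1 [:: l; GenTree.Leaf x; r] =>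
      if (tree_decode l, tree_decode r) is (Some l', Some r')
      then Some (Node l' x r') else None
  | _ => None
  end.

Lemma tree_encodeK : pcancel tree_encode tree_decode.
Proof. by elim=> //= l -> x r ->. Qed.

End TreeChoice.

HB.instance Definition _ (T : eqType) :=
  Equality.copy (tree T) (pcan_type (@tree_encodeK T)).
HB.instance Definition _ (T : choiceType) :=
  Choice.copy (tree T) (pcan_type (@tree_encodeK T)).
HB.instance Definition _ (T : countType) :=
  Countable.copy (tree T) (pcan_type (@tree_encodeK T)).

Definition bintree := tree unit.

Fixpoint forget (T : Type) (t : tree T) : bintree :=
  if t is Node l _ r then Node (forget l) tt (forget r) else Leaf.

Fixpoint nodes (T : Type) (t : tree T) : nat :=
  if t is Node l _ r then (nodes l + nodes r).+1 else 0%N.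

(* The orientations of the leaves of [t], from left to right, a leaf being sent
   to [false] (0) if it is a right child and to [true] (1) if it is a left
   child; [o] is the orientation of [t] itself. *)
Fixpoint leaves (T : Type) (o : bool) (t : tree T) : seq bool :=
  if t is Node l _ r then leaves true l ++ leaves false r else [:: o].

(* [o] does not matter: the first and the last leaves are dropped. *)
Definition canopy (T : Type) (t : tree T) : seq bool :=
  if leaves false t is _ :: o :: s then belast o s else [::].

Definition twin (J : bintree * bintree) : bool :=
  (nodes J.1 == nodes J.2) &&
  [forall i : 'I_(nodes J.1).-1,
    nth false (canopy J.1) i != nth false (canopy J.2) i].

Record TBT : predArgType :=
  TwinTrees { trees :> bintree * bintree; _ : twin trees }.

HB.instance Definition _ := [isSub for trees].
HB.instance Definition _ := [Countable of TBT by <:].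

Definition TBT_size (J : TBT) : nat := nodes (trees J).1.

Fixpoint leaf_insert (a : nat) (t : tree nat) : tree nat :=
  if t is Node l b r then
    if (a < b)%N then Node (leaf_insert a l) b r
    else Node l b (leaf_insert a r)
  else Node Leaf a Leaf.

(* [lower a t] and [upper a t] are the restrictions of the binary search tree
   [t] to its labels [<= a] and [> a]; [lowerP] and [upperP] show that they are
   the only binary search trees on these labels whose ancestor relation is
   included in that of [t]. *)
Fixpoint lower (a : nat) (t : tree nat) : tree nat :=
  if t is Node l b r then
    if (b <= a)%N then Node l b (lower a r) else lower a l
  else Leaf.

Fixpoint upper (a : nat) (t : tree nat) : tree nat :=
  if t is Node l b r then
    if (a < b)%N then Node (upper a l) b r else upper a r
  else Leaf.

Definition root_insert (a : nat) (t : tree nat) : tree nat :=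
  Node (lower a t) a (upper a t).

Definition insert_pair (T : tree nat * tree nat) (a : nat) :
    tree nat * tree nat :=
  (leaf_insert a T.1, root_insert a T.2).

Definition Psymbol (s : seq nat) : bintree * bintree :=
  let T := foldl insert_pair (Leaf, Leaf) s in (forget T.1, forget T.2).

Definition baxter_le (J0 J1 : TBT) : Prop :=
  exists s0 s1 : perm_word,
    [/\ Psymbol s0 = J0, Psymbol s1 = J1 & perm_le s0 s1].

(* There is exactly one Baxter permutation with a given symbol. *)
Definition TBT_connected (J : TBT) : Prop :=
  exists s : perm_word, [/\ is_baxter s, Psymbol s = J & perm_connected s].

Definition nonempty_connected : pred TBT :=
  fun J => (0 < TBT_size J)%N && `[< TBT_connected J >].

Section Restriction.
Implicit Types (t : tree nat) (a x y : nat).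

Fixpoint inorder t : seq nat :=
  if t is Node l b r then inorder l ++ b :: inorder r else [::].

(* strictly increasing, since the labels are distinct letters *)
Definition bst t : bool := sorted ltn (inorder t).

Fixpoint ancestor t x y : bool :=
  if t is Node l b r then
    [|| (x == b) && (y \in inorder t), ancestor l x y | ancestor r x y]
  else false.

Lemma bst_Node l b r :
  bst (Node l b r) = [&& all (fun x => x < b)%N (inorder l),
                         all (fun x => b < x)%N (inorder r), bst l & bst r].
Proof.
rewrite /bst /= !(sorted_pairwise ltn_trans) pairwise_cat /=.
rewrite allrel_consr; apply/idP/idP => [|].
  by case/and3P=> /andP[-> _] -> /andP[-> ->].
case/and4P=> lb rb -> ->; rewrite lb rb /= !andbT.
apply/allrelP=> x y xl yr.
exact: ltn_trans (allP lb x xl) (allP rb y yr).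
Qed.

Lemma ancestor_in t x y :
  ancestor t x y -> (x \in inorder t) /\ (y \in inorder t).
Proof.
elim: t => //= l IHl b r IHr; rewrite !mem_cat !inE.
case/or3P=> [/andP[/eqP-> ->]|/IHl[-> ->]|/IHr[-> ->]];
  by rewrite ?eqxx ?orbT.
Qed.

Lemma ancestor_anti t x y :
  bst t -> ancestor t x y -> ancestor t y x -> x = y.
Proof.
elim: t => // l IHl b r IHr; rewrite bst_Node => /and4P[lb rb bl br] /=.
have Nl z : ancestor l z b -> False.
  by case/ancestor_in=> _ /(allP lb); rewrite ltnn.
have Nr z : ancestor r z b -> False.
  by case/ancestor_in=> _ /(allP rb); rewrite ltnn.
have Nlr u v u' v' : ancestor l u v -> ancestor r u' v' ->
    (u' == u) || (u' == v) || (v' == u) || (v' == v) -> False.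
  move=> /ancestor_in[/(allP lb) h1 /(allP lb) h2].
  move=> /ancestor_in[/(allP rb) h3 /(allP rb) h4].
  by case/orP=> [/orP[/orP[]|]|] /eqP h; subst;
     [move: (ltn_trans h1 h3)|move: (ltn_trans h2 h3)
     |move: (ltn_trans h1 h4)|move: (ltn_trans h2 h4)]; rewrite ltnn.
case/or3P=> [/andP[/eqP-> _]|xy|xy]; case/or3P=> [/andP[/eqP y_b _]|yx|yx].
- by [].
- by case: (Nl _ yx).
- by case: (Nr _ yx).
- by subst; case: (Nl _ xy).
- exact: IHl.
- by case: (Nlr _ _ _ _ xy yx); rewrite eqxx ?orbT.
- by subst; case: (Nr _ xy).
- by case: (Nlr _ _ _ _ yx xy); rewrite eqxx ?orbT.
- exact: IHr.
Qed.

Lemma bst_restriction_uniq t t1 t2 :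
  bst t -> bst t1 -> bst t2 -> inorder t1 =i inorder t2 ->
  (forall x y, ancestor t1 x y -> ancestor t x y) ->
  (forall x y, ancestor t2 x y -> ancestor t x y) -> t1 = t2.
Proof.
move=> bt; elim: t1 t2 => [|l1 IHl b1 r1 IHr] [|l2 b2 r2] //.
- by move=> _ _ /(_ b2); rewrite /= mem_cat !inE eqxx orbT.
- by move=> _ _ /(_ b1); rewrite /= mem_cat !inE eqxx orbT.
rewrite !bst_Node => /and4P[lb1 rb1 bl1 br1] /and4P[lb2 rb2 bl2 br2] e a1 a2.
have b12 : b1 = b2.
  apply: (ancestor_anti bt).
    by apply: a1; rewrite /= eqxx /= -/(inorder (Node l1 b1 r1)) e /=;
       rewrite mem_cat inE eqxx orbT.
  by apply: a2; rewrite /= eqxx /= -/(inorder (Node l2 b2 r2)) -e /=;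
     rewrite mem_cat inE eqxx orbT.
subst b2; congr Node; [apply: IHl | apply: IHr] => // x.
- have := e x; rewrite /= !mem_cat !inE.
  have [xb|] := ltnP x b1.
    rewrite (ltn_eqF xb) /=.
    have Nr s : all (fun x => b1 < x)%N s -> (x \in s) = false.
      move=> /allP sb; apply/negP=> /sb bx.
      by have := ltn_trans xb bx; rewrite ltnn.
    by rewrite (Nr _ rb1) (Nr _ rb2) !orbF.
  move=> bx _; rewrite (_ : x \in inorder l1 = false).
    by apply/esym/negP=> /(allP lb2); rewrite ltnNge bx.
  by apply/negP=> /(allP lb1); rewrite ltnNge bx.
- by move=> y xy; apply: a1; rewrite /= xy orbT.
- by move=> y xy; apply: a2; rewrite /= xy orbT.
- have := e x; rewrite /= !mem_cat !inE.
  have [bx|] := ltnP b1 x.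
    rewrite (gtn_eqF bx) /=.
    have Nl s : all (fun x => x < b1)%N s -> (x \in s) = false.
      move=> /allP sb; apply/negP=> /sb xb.
      by have := ltn_trans xb bx; rewrite ltnn.
    by rewrite (Nl _ lb1) (Nl _ lb2).
  move=> xb _; rewrite (_ : x \in inorder r1 = false).
    by apply/esym/negP=> /(allP rb2); rewrite ltnNge xb.
  by apply/negP=> /(allP rb1); rewrite ltnNge xb.
- by move=> y xy; apply: a1; rewrite /= xy !orbT.
- by move=> y xy; apply: a2; rewrite /= xy !orbT.
Qed.

Lemma filter_all (p : pred nat) s :
  {in s, forall x, p x} -> filter p s = s.
Proof. by move=> h; apply/all_filterP/allP. Qed.

Lemma filter_none (p : pred nat) s :
  {in s, forall x, ~~ p x} -> filter p s = [::].
Proof.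
by move=> h; rewrite -(filter_pred0 s); apply: eq_in_filter => x /h/negbTE.
Qed.

Lemma inorder_lower a t :
  bst t -> inorder (lower a t) = [seq x <- inorder t | (x <= a)%N].
Proof.
elim: t => // l IHl b r IHr; rewrite bst_Node => /and4P[lb rb bl br] /=.
rewrite filter_cat /=; case: ifP => ba /=.
  rewrite IHr // (@filter_all _ (inorder l)) // => x /(allP lb) xb.
  exact: leq_trans (ltnW xb) ba.
rewrite IHl // (@filter_none _ (inorder r)) ?cats0 // => x /(allP rb) bx.
by rewrite -ltnNge; apply: ltn_trans bx; rewrite ltnNge ba.
Qed.

Lemma inorder_upper a t :
  bst t -> inorder (upper a t) = [seq x <- inorder t | (a < x)%N].
Proof.
elim: t => // l IHl b r IHr; rewrite bst_Node => /and4P[lb rb bl br] /=.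
rewrite filter_cat /=; case: ifP => ab /=.
  rewrite IHl // (@filter_all _ (inorder r)) // => x /(allP rb).
  exact: ltn_trans.
rewrite IHr // (@filter_none _ (inorder l)) // => x /(allP lb) xb.
by rewrite -leqNgt; apply: leq_trans (ltnW xb) _; rewrite leqNgt ab.
Qed.

Lemma ancestor_lower a t x y :
  bst t -> ancestor (lower a t) x y -> ancestor t x y.
Proof.
elim: t => // l IHl b r IHr bt; have := bt.
rewrite bst_Node => /and4P[lb rb bl br] /=; case: ifP => ba /=; last first.
  by move=> /(IHl bl)->; rewrite orbT.
rewrite inorder_lower // !mem_cat !inE mem_filter.
by case/or3P=> [/andP[-> /or3P[->|->|/andP[_ ->]]]|->|/(IHr br)->];
   rewrite ?orbT.
Qed.

Lemma ancestor_upper a t x y :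
  bst t -> ancestor (upper a t) x y -> ancestor t x y.
Proof.
elim: t => // l IHl b r IHr bt; have := bt.
rewrite bst_Node => /and4P[lb rb bl br] /=; case: ifP => ba /=; last first.
  by move=> /(IHr br)->; rewrite !orbT.
rewrite inorder_upper // !mem_cat !inE mem_filter.
by case/or3P=> [/andP[-> /or3P[/andP[_ ->]|->|->]]|/(IHl bl)->|->];
   rewrite ?orbT.
Qed.

Lemma lowerP a t t' : bst t ->
  t' = lower a t <->
  [/\ bst t', forall x, (x \in inorder t') = (x \in inorder t) && (x <= a)%N
    & forall x y, ancestor t' x y -> ancestor t x y].
Proof.
move=> bt; have bl : bst (lower a t).
  by rewrite /bst inorder_lower // sorted_filter //; apply: ltn_trans.
have il x : (x \in inorder (lower a t)) = (x \in inorder t) && (x <= a)%N.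
  by rewrite inorder_lower // mem_filter andbC.
split=> [->|[bt' it' at']]; first by split=> // x y; apply: ancestor_lower.
apply: (bst_restriction_uniq bt) => // [x|x y]; first by rewrite it' il.
exact: ancestor_lower.
Qed.

Lemma upperP a t t' : bst t ->
  t' = upper a t <->
  [/\ bst t', forall x, (x \in inorder t') = (x \in inorder t) && (a < x)%N
    & forall x y, ancestor t' x y -> ancestor t x y].
Proof.
move=> bt; have bl : bst (upper a t).
  by rewrite /bst inorder_upper // sorted_filter //; apply: ltn_trans.
have il x : (x \in inorder (upper a t)) = (x \in inorder t) && (a < x)%N.
  by rewrite inorder_upper // mem_filter andbC.
split=> [->|[bt' it' at']]; first by split=> // x y; apply: ancestor_upper.
apply: (bst_restriction_uniq bt) => // [x|x y]; first by rewrite it' il.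
exact: ancestor_upper.
Qed.

End Restriction.

Lemma shuffle0s t : shuffle [::] t = [:: t]. Proof. by []. Qed.
Lemma shuffles0 s : shuffle s [::] = [:: s]. Proof. by case: s. Qed.

Lemma big_shuffle_cons (V : nmodType) (F : seq nat -> V) a s b t :
  \sum_(w <- shuffle (a :: s) (b :: t)) F w =
  \sum_(w <- shuffle s (b :: t)) F (a :: w) +
  \sum_(w <- shuffle (a :: s) t) F (b :: w).
Proof. by rewrite /= big_cat !big_map. Qed.

Lemma shuffle_assoc (V : nmodType) (F : seq nat -> V) s t u :
  \sum_(x <- shuffle s t) \sum_(w <- shuffle x u) F w =
  \sum_(y <- shuffle t u) \sum_(w <- shuffle s y) F w.
Proof.
have [n] := ubnP (size s + size t + size u)%N.
elim: n => // n IHn in s t u F *; rewrite ltnS => le_n.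
case: s le_n => [|a s] le_n.
  by rewrite shuffle0s big_seq1; apply: eq_bigr => y _; rewrite big_seq1.
case: t le_n => [|b t] le_n.
  by rewrite shuffles0 shuffle0s !big_seq1.
case: u le_n => [|c u] le_n.
  rewrite shuffles0 big_seq1.
  by apply: eq_bigr => x _; rewrite shuffles0 big_seq1.
rewrite !big_shuffle_cons.
under eq_bigr do rewrite big_shuffle_cons.
under [X in _ + X]eq_bigr do rewrite big_shuffle_cons.
under [X in _ = X + _]eq_bigr do rewrite big_shuffle_cons.
under [X in _ = _ + X]eq_bigr do rewrite big_shuffle_cons.
rewrite !big_split /=.
have IH1 := IHn s (b :: t) (c :: u) (fun w => F (a :: w)) le_n.
have lt2 : (size (a :: s) + size t + size (c :: u) < n)%N.
  by rewrite -addSn -addnS.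
have lt3 : (size (a :: s) + size (b :: t) + size u < n)%N by rewrite -addnS.
have IH2 := IHn (a :: s) t (c :: u) (fun w => F (b :: w)) lt2.
have IH3 := IHn (a :: s) (b :: t) u (fun w => F (c :: w)) lt3.
rewrite !big_shuffle_cons in IH1 IH3.
by rewrite addrACA IH1 IH2 IH3 addrACA -!addrA.
Qed.

Lemma perm_shuffle s t w : w \in shuffle s t -> perm_eq w (s ++ t).
Proof.
elim: s t w => [|x s IHs] t w; first by rewrite inE => /eqP->.
elim: t w => [|y t IHt] w; first by rewrite inE cats0 => /eqP->.
rewrite mem_cat => /orP[] /mapP[v + ->].
  by move=> /IHs; rewrite /= perm_cons.
move=> /IHt h; rewrite -[X in perm_eq _ X]/((x :: s) ++ [:: y] ++ t).
by rewrite perm_sym perm_catCA /= perm_cons perm_sym.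
Qed.

Lemma shuffle_map (f : nat -> nat) s t :
  shuffle (map f s) (map f t) = map (map f) (shuffle s t).
Proof.
elim: s t => //= x s IHs; elim=> //= y t IHt.
rewrite -[f y :: map f t]/(map f (y :: t)) IHs IHt map_cat -!map_comp.
by congr (_ ++ _); apply: eq_map.
Qed.

Lemma perm_word_over (s t : perm_word) :
  perm_eq (s ++ shift (size s) t) (iota 1 (size s + size t)).
Proof.
rewrite iotaD perm_cat //; first by case: s.
by rewrite addnC iotaDl; apply: perm_map; case: t.
Qed.

Lemma shuffle_perm_word (s t : perm_word) w :
  w \in shuffle s (shift (size s) t) -> perm_eq w (iota 1 (size w)).
Proof.
move=> /perm_shuffle h; rewrite (perm_size h) size_cat size_map.
by apply: perm_trans h _; apply: perm_word_over.
Qed.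

Lemma val_sshuffle (s t : perm_word) :
  map word (sshuffle s t) = shuffle s (shift (size s) t).
Proof.
rewrite /sshuffle; have := @shuffle_perm_word s t.
elim: (shuffle _ _) => //= w l IHl h.
rewrite insubT ?h ?mem_head // => hw /=; rewrite IHl // => v vl.
by apply: h; rewrite inE vl orbT.
Qed.

Section LinearExtension.
Context {I : choiceType} {R : comNzRingType} {V : lmodType R}.
Variable h : I -> V.

Definition linext (f : {malg R[I]}) : V := \sum_(i <- msupp f) f@_i *: h i.

Lemma linextE f : linext f = \sum_(i <- msupp f) f@_i *: h i.
Proof. by []. Qed.

Lemma linextw (d : {fset I}) f :
  (msupp f `<=` d)%fset -> linext f = \sum_(i <- d) f@_i *: h i.
Proof.
move=> le; rewrite [LHS](big_fset_incl _ le) => //= x xd /mcoeff_outdom ->.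
by rewrite scale0r.
Qed.

Lemma linext_is_linear : linear linext.
Proof.
move=> c f g.
have le1 : (msupp (c *: f + g) `<=` msupp f `|` msupp g)%fset.
  apply: (fsubset_trans (msuppD_le _ _)); apply: fsetSU; exact: msuppZ_le.
rewrite (linextw le1) (linextw (fsubsetUl _ (msupp g))).
rewrite (linextw (fsubsetUr (msupp f) _)).
rewrite scaler_sumr -big_split; apply: eq_bigr => i _ /=.
by rewrite mcoeffD mcoeffZ scalerDl scalerA.
Qed.

HB.instance Definition _ :=
  GRing.isLinear.Build R {malg R[I]} V *:%R linext linext_is_linear.

Lemma linextZU c i : linext << c *g i >> = c *: h i.
Proof. by rewrite (linextw msuppU_le) big_seq_fset1 mcoeffUU. Qed.

Lemma linextU i : linext << i >> = h i.
Proof. by rewrite linextZU scale1r. Qed.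

Lemma linext_unique (g : {linear {malg R[I]} -> V}) :
  (forall i, g << i >> = h i) -> g =1 linext.
Proof.
move=> gh f; rewrite [in LHS](monalgE f) linear_sum; apply: eq_bigr => i _.
rewrite -gh -linearZ; congr (g _).
by apply/malgP=> j; rewrite mcoeffZ !mcoeffU mulrnAr mulr1.
Qed.

End LinearExtension.

Lemma perm_word_nil : perm_eq [::] (iota 1 (size ([::] : seq nat))).
Proof. by []. Qed.

Definition empty_perm : perm_word := PermWord perm_word_nil.

Section FQSym.
Variable K : fieldType.

Definition FQSym := {malg K[perm_word]}.

HB.instance Definition _ := GRing.Lmodule.on FQSym.

Definition basisF (s : perm_word) : FQSym := << s >>.

Definition basisF_mul (s t : perm_word) : FQSym :=
  \sum_(p <- sshuffle s t) basisF p.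

Definition FQSym_mul (f g : FQSym) : FQSym :=
  linext (fun s => linext (basisF_mul s) g) f.

Definition FQSym_one : FQSym := basisF empty_perm.

Lemma FQSym_mulF s t : FQSym_mul (basisF s) (basisF t) = basisF_mul s t.
Proof. by rewrite /FQSym_mul !linextU. Qed.

Lemma FQSym_mulDl : left_distributive FQSym_mul +%R.
Proof. by move=> f g h; rewrite /FQSym_mul linearD. Qed.

Lemma FQSym_mulDr : right_distributive FQSym_mul +%R.
Proof.
move=> f g h; rewrite /FQSym_mul !linextE -big_split; apply: eq_bigr => s _.
by rewrite linearD scalerDr.
Qed.

Lemma FQSym_mulZl c f g : FQSym_mul (c *: f) g = c *: FQSym_mul f g.
Proof. by rewrite /FQSym_mul linearZ. Qed.

Lemma FQSym_mulZr c f g : FQSym_mul f (c *: g) = c *: FQSym_mul f g.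
Proof.
rewrite /FQSym_mul !linextE scaler_sumr; apply: eq_bigr => s _.
by rewrite linearZ /= scalerA mulrC -scalerA.
Qed.

Lemma FQSym_mul0f f : FQSym_mul 0 f = 0.
Proof. by rewrite -(scale0r 0) FQSym_mulZl !scale0r. Qed.

Lemma FQSym_mulf0 f : FQSym_mul f 0 = 0.
Proof. by rewrite -(scale0r 0) FQSym_mulZr !scale0r. Qed.

Lemma FQSym_ind (Q : FQSym -> Prop) :
  Q 0 -> (forall c s f, Q f -> Q (c *: basisF s + f)) -> forall f, Q f.
Proof.
move=> Q0 QD f; rewrite (monalgE f); elim/big_rec: _ => // s g _ Qg.
rewrite (_ : << _ *g s >> = f@_s *: basisF s); first exact: QD.
by apply/malgP=> j; rewrite mcoeffZ !mcoeffU mulrnAr mulr1.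
Qed.

Let word_basis (w : seq nat) : FQSym :=
  if insub w is Some p then basisF p else 0.

Let basisF_mulE s t :
  basisF_mul s t =
  \sum_(w <- shuffle s (shift (size s) t)) word_basis w.
Proof.
rewrite -val_sshuffle big_map; apply: eq_bigr => p _.
by rewrite /word_basis valK.
Qed.

Lemma basisF_mulA s t u :
  FQSym_mul (basisF s) (basisF_mul t u) =
  FQSym_mul (basisF_mul s t) (basisF u).
Proof.
rewrite (big_morph _ (FQSym_mulDr _) (FQSym_mulf0 _)).
rewrite (big_morph (FQSym_mul^~ (basisF u)) (fun f g => FQSym_mulDl f g _)
          (FQSym_mul0f _)).
under eq_bigr do rewrite FQSym_mulF basisF_mulE.
under [RHS]eq_bigr do rewrite FQSym_mulF basisF_mulE.
rewrite -(big_map word predT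
  (fun q => \sum_(w <- shuffle s (shift (size s) q)) word_basis w)).
rewrite -(big_map word predT
  (fun p => \sum_(w <- shuffle p (shift (size p) u)) word_basis w)).
rewrite !val_sshuffle.
transitivity (\sum_(x <- shuffle s (shift (size s) t))
    \sum_(w <- shuffle x (shift (size s) (shift (size t) u))) word_basis w).
  by rewrite shuffle_assoc /shift shuffle_map big_map.
apply: eq_big_seq => x /perm_shuffle /perm_size.
rewrite size_cat size_map => ->; rewrite /shift -map_comp.
by under [in RHS]eq_map do rewrite -addnA.
Qed.

Lemma FQSym_mulA : associative FQSym_mul.
Proof.
move=> f g h; elim/FQSym_ind: f => [|a s f IHf].
  by rewrite !FQSym_mul0f.
rewrite !FQSym_mulDl IHf !FQSym_mulZl.
suff -> : FQSym_mul (basisF s) (FQSym_mul g h) =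
          FQSym_mul (FQSym_mul (basisF s) g) h by [].
elim/FQSym_ind: g {f IHf} => [|b t g IHg].
  by rewrite FQSym_mulf0 !FQSym_mul0f FQSym_mulf0.
rewrite FQSym_mulDl !FQSym_mulDr FQSym_mulDl IHg.
rewrite FQSym_mulZl !FQSym_mulZr FQSym_mulZl.
suff -> : FQSym_mul (basisF s) (FQSym_mul (basisF t) h) =
          FQSym_mul (FQSym_mul (basisF s) (basisF t)) h by [].
elim/FQSym_ind: h {g IHg} => [|c u h IHh].
  by rewrite !FQSym_mulf0.
rewrite !FQSym_mulDr IHh !FQSym_mulZr.
by rewrite !FQSym_mulF basisF_mulA.
Qed.

Lemma FQSym_mul1f : left_id FQSym_one FQSym_mul.
Proof.
elim/FQSym_ind=> [|c s f IHf]; first exact: FQSym_mulf0.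
rewrite FQSym_mulDr IHf FQSym_mulZr.
suff -> : FQSym_mul FQSym_one (basisF s) = basisF s by [].
rewrite FQSym_mulF basisF_mulE big_seq1 /word_basis.
by rewrite (_ : shift _ _ = s) ?valK //; apply: map_id.
Qed.

Lemma FQSym_mulf1 : right_id FQSym_one FQSym_mul.
Proof.
elim/FQSym_ind=> [|c s f IHf]; first exact: FQSym_mul0f.
rewrite FQSym_mulDl IHf FQSym_mulZl.
suff -> : FQSym_mul (basisF s) FQSym_one = basisF s by [].
by rewrite FQSym_mulF basisF_mulE shuffles0 big_seq1 /word_basis valK.
Qed.

Lemma FQSym_one_neq0 : FQSym_one != 0.
Proof. by rewrite monalgU_eq0 oner_neq0. Qed.

HB.instance Definition _ := GRing.Zmodule_isNzRing.Build FQSym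
  FQSym_mulA FQSym_mul1f FQSym_mulf1 FQSym_mulDl FQSym_mulDr FQSym_one_neq0.

HB.instance Definition _ := GRing.Lmodule_isLalgebra.Build K FQSym
  (fun c f g => esym (FQSym_mulZl c f g)).

HB.instance Definition _ := GRing.Lalgebra_isAlgebra.Build K FQSym
  (fun c f g => esym (FQSym_mulZr c f g)).

End FQSym.

Local Open Scope classical_set_scope.

Section Baxter.
Variable K : fieldType.

(* Both sums are over finite sets, see [finite_symbol] and [finite_baxter_le]. *)
Definition basisP (J : TBT) : FQSym K :=
  \sum_(s \in [set s : perm_word | Psymbol s = J]) basisF K s.

Definition basisE (J : TBT) : FQSym K :=
  \sum_(J' \in [set J' : TBT | baxter_le J J']) basisP J'.

(* the linear span of the [basisP J] *)
Definition Baxter : set (FQSym K) := range (linext basisP).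

End Baxter.

Arguments Baxter : clear implicits.

Lemma nodes_forget T (t : tree T) : nodes (forget t) = nodes t.
Proof. by elim: t => //= l -> _ r ->. Qed.

Lemma nodes_leaf_insert a t : nodes (leaf_insert a t) = (nodes t).+1.
Proof.
by elim: t => //= l IHl b r IHr; case: ifP => _ /=; rewrite ?IHl ?IHr ?addnS.
Qed.

Lemma nodes_Psymbol s : nodes (Psymbol s).1 = size s.
Proof.
suff h T : nodes (foldl insert_pair T s).1 = (size s + nodes T.1)%N.
  by rewrite /Psymbol nodes_forget h addn0.
elim: s T => //= a s IHs T.
by rewrite IHs nodes_leaf_insert addnS.
Qed.

Lemma finite_perm_word n : finite_set [set s : perm_word | size s = n].
Proof.
apply: (@sub_finite_set _ _
  [set` pmap (@insub _ _ perm_word) (permutations (iota 1 n))]) => [s /= sn|].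
  by rewrite mem_pmap_sub mem_permutations -sn; case: s {sn}.
exact: finite_seq.
Qed.

Lemma finite_symbol (J : TBT) :
  finite_set [set s : perm_word | Psymbol s = J].
Proof.
apply: sub_finite_set (finite_perm_word (TBT_size J)) => s /= sJ.
by rewrite -nodes_Psymbol sJ.
Qed.

Lemma perm_le_size s t : perm_le s t -> size s = size t.
Proof.
elim=> [x y [u [v [a [b [_ -> ->]]]]]|//|x y z _ -> _ -> //].
by rewrite !size_cat.
Qed.

Lemma finite_baxter_le (J : TBT) :
  finite_set [set J' : TBT | baxter_le J J'].
Proof.
have fin : finite_set
    (trees @^-1` [set Psymbol s | s in [set s : perm_word | size s = TBT_size J]]).
  apply: finite_preimage; first by move=> J1 J2 _ _; apply: val_inj.
  exact/finite_image/finite_perm_word.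
apply: sub_finite_set fin => J' /= [s0 [s1 [s0J s1J' le01]]].
by exists s1 => //=; rewrite -(perm_le_size le01) -nodes_Psymbol s0J.
Qed.

Section Free.
Context {K : fieldType} {A : algType K} {I : choiceType}.
Variable e : I -> A.

(* The free algebra on [I] is the algebra of the free monoid on [I]. *)
Definition free_eval : {malg K[{fmonom I}]} -> A :=
  linext (fun m : {fmonom I} => \prod_(i <- (m : seq I)) e i).

HB.instance Definition _ := GRing.Linear.on free_eval.

Lemma free_eval_gen i : free_eval << fmu i >> = e i.
Proof. by rewrite /free_eval linextU fmuE big_seq1. Qed.

Lemma free_eval_is_monoid_morphism : monoid_morphism free_eval.
Proof.
split=> [|f g]; first by rewrite /free_eval linextU fm1 big_nil.
rewrite malgME linear_sum [in RHS]/free_eval !linextE mulr_suml.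
apply: eq_bigr => m _; rewrite linear_sum mulr_sumr.
apply: eq_bigr => m' _; rewrite /= /free_eval linextZU fmM big_cat /=.
by rewrite -scalerAl -scalerAr scalerA.
Qed.

HB.instance Definition _ := GRing.isMonoidMorphism.Build
  {malg K[{fmonom I}]} A free_eval free_eval_is_monoid_morphism.

Definition freely_generates (B : set A) : Prop :=
  injective free_eval /\ range free_eval = B.

End Free.

(* Main.v *)
Require Import Defs.
From Stdlib Require Import Relation_Operators.
From mathcomp Require Import all_boot all_order all_algebra.
From mathcomp Require Import finmap zify.
From mathcomp Require Import boolp classical_sets functions cardinality fsbigop.
From mathcomp Require Import monalg.

(** A permutation is turned into a pair of twin trees by forgetting part of
    the order of its letters.  Exchanging two neighbours [a], [d] does not
    change the trees when some value between [a] and [d] occurs before them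
    and some other one after them ([Psymbol_swap]); on the other hand, the
    trees force [d] to precede [a < d] as soon as [d] is the first, or [a] the
    last, of the letters with values in the interval from [a] to [d]
    ([forced], [forced_class]).

    Call a permutation reduced if no descent can be undone by such an
    exchange.  A reduced permutation lies, in the permutohedron order, below
    every permutation having its forced inversions ([reduced_inv_le]).  As
    forced inversions depend only on the trees and can only increase along the
    order, each class contains exactly one reduced permutation [s], and the
    classes above the one of [s] contain exactly the permutations above [s]
    ([reduced_le_class]).  Hence [basisE] at the class of [s] is the sum
    [upper_sum s] of the basis elements F over the upper set of [s]
    ([basisE_upper_sum]).

    These sums are multiplicative for the operation [s / t] ([upper_sum_mul]),
    because the inversions of [s / t] are those of [s] and those of [t].
    Moreover [s / t] is reduced if and only if [s] and [t] are
    ([reduced_over]), and every permutation is a product of nonempty connected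
    ones in a unique way ([exists_atoms], [overs_inj]).  So the monomials in
    the generators are the elements [upper_sum s], each reduced [s] being
    reached exactly once.  Counting inversions shows that these are linearly
    independent ([free_eval_inj]) and span the same space as the elements
    [basisP] ([range_eval]).

    It remains to see that connectedness, which is a condition on the Baxter
    permutation of the class, may be tested on the reduced one
    ([connected_class]).  A permutation that starts with its [k] smallest
    letters has a Baxter permutation with the same property
    ([splits_at_baxter]), since a violation at minimal distance would be a
    pattern 2-41-3.  The existence of a Baxter permutation in every class
    ([exists_baxter]) is proved by putting pairs of letters in the right
    relative order, by increasing difference of their values. *)

Set Implicit Arguments.
Unset Strict Implicit.
Unset Printing Implicit Defensive.

(** Two convertible presentations of the type of natural numbers occur in
    sizes and indices, and [lia] takes them for different atoms. *)
Ltac nlia :=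
  repeat match goal with
  | H : context [Equality.sort Datatypes_nat__canonical__eqtype_Equality]
    |- _ =>
      change (Equality.sort Datatypes_nat__canonical__eqtype_Equality)
        with nat in H
  end;
  change (Equality.sort Datatypes_nat__canonical__eqtype_Equality) with nat;
  lia.

(** * Words and the relative order of their letters *)

Section Words.
Implicit Types (s t u v : seq nat) (a b c d q r x y z : nat).

Definition prec s x y := index x s < index y s.

Lemma prec_filter (p : pred nat) s x y :
  p x -> p y -> prec (filter p s) x y = prec s x y.
Proof.
rewrite /prec => px py; elim: s => //= h s IHs.
case ph: (p h) => /=.
  by case: eqP => _; case: eqP => _ //; rewrite ltnS IHs.
rewrite IHs; case: eqP => [e|_]; first by rewrite e px in ph.
by case: eqP => [e|_]; [rewrite e py in ph | rewrite ltnS].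
Qed.

Lemma index_rev s x : uniq s -> x \in s ->
  index x (rev s) = (size s - (index x s).+1).
Proof.
move=> us xs; have lx : index x s < size s by rewrite index_mem.
have e : nth 0 (rev s) (size s - (index x s).+1) = x.
  rewrite nth_rev; last by nlia.
  by have -> : size s - (size s - (index x s).+1).+1 = index x s;
    [nlia | rewrite nth_index].
by rewrite -[in LHS]e index_uniq ?rev_uniq ?size_rev //; nlia.
Qed.

Lemma prec_rev s x y : uniq s -> x \in s -> y \in s ->
  prec (rev s) x y = prec s y x.
Proof.
move=> us xs ys; rewrite /prec !index_rev //.
by move: xs ys; rewrite -!index_mem; nlia.
Qed.

Lemma index_inj_mem s x y : x \in s -> index x s = index y s -> x = y.
Proof.
move=> xs e; have ys : y \in s by rewrite -index_mem -e index_mem.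
by rewrite -(nth_index 0 xs) e nth_index.
Qed.

Lemma prec_total s x y : x \in s -> x <> y -> prec s x y \/ prec s y x.
Proof.
move=> xs ne; rewrite /prec; case: ltngtP => //; [by left|by right|].
by move/(index_inj_mem xs).
Qed.

(** Every pattern of two adjacent letters is found in this way: on the way
    from a letter satisfying [p] to one that does not, two neighbours
    disagree. *)
Lemma crossing (p : pred nat) s x y :
  uniq s -> x \in s -> y \in s -> prec s x y -> p x -> ~~ p y ->
  exists q r, [/\ q \in s, r \in s, p q, ~~ p r &
    [/\ index r s = (index q s).+1, index x s <= index q s
      & index r s <= index y s]].
Proof.
rewrite /prec => us xs ys xy px py.
pose f k := (index x s < k) && ~~ p (nth 0 s k).
have ex : exists k, f k by exists (index y s); rewrite /f nth_index // py xy.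
case: (ex_minnP ex) => k /andP[xk pk] kmin.
have ky : k <= index y s by apply: kmin; rewrite /f nth_index // py xy.
have ks : k < size s by apply: leq_ltn_trans ky _; rewrite index_mem.
case: k xk pk kmin ky ks => // k xk pk kmin ky ks.
have pk1 : p (nth 0 s k).
  move: xk; rewrite ltnS leq_eqVlt => /orP[/eqP <-|xk]; first
    by rewrite nth_index.
  by apply/negPn/negP => npk; have := kmin k;
    rewrite /f xk npk ltnn => /(_ isT).
exists (nth 0 s k), (nth 0 s k.+1).
by rewrite !mem_nth ?index_uniq //; nlia.
Qed.

Lemma adjacent_split s q r : uniq s -> q \in s -> r \in s ->
  index r s = (index q s).+1 ->
  exists u v, [/\ s = u ++ [:: q, r & v],
    forall x, x \in s -> prec s x q -> x \in u &
    forall y, y \in s -> prec s r y -> y \in v].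
Proof.
move=> us qs rs e; have lq : index q s < size s by rewrite index_mem.
have lr : (index q s).+1 < size s by rewrite -e index_mem.
exists (take (index q s) s), (drop (index q s).+2 s); split.
- rewrite -[LHS](cat_take_drop (index q s)) (drop_nth 0) // (drop_nth 0) //.
  by rewrite nth_index // -e nth_index.
- by move=> x xs xq; rewrite in_take.
- move=> y ys; rewrite /prec e => ry.
  move: (ys); rewrite -{1}(cat_take_drop (index q s).+2 s) mem_cat.
  by case/orP => //; rewrite in_take // ltnNge ry.
Qed.

Lemma split_adjacent u v q r (s := u ++ [:: q, r & v]) : uniq s ->
  [/\ index q s = size u, index r s = (size u).+1,
     forall x, x \in u -> prec s x q & forall y, y \in v -> prec s r y].
Proof.
move=> us; have := us; rewrite /s cat_uniq /= !inE !negb_or.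
case/and4P => _ /and3P[qu ru nv] /andP[/negbTE qr qv] /andP[rv _].
have eq : index q s = size u by rewrite /s index_cat (negbTE qu) /= eqxx addn0.
have er : index r s = (size u).+1.
  by rewrite /s index_cat (negbTE ru) /= qr eqxx addn1.
split=> // [x xu|y yv]; rewrite /prec ?eq ?er.
  by rewrite /s index_cat xu index_mem.
rewrite /s index_cat ifN; last exact: contra (hasPn nv y yv).
rewrite /= ifN; last by apply: contraNneq qv => ->.
by rewrite ifN; [nlia | apply: contraNneq rv => ->].
Qed.

Lemma mem_adjacent u v q r x : x \in u ++ [:: q, r & v] ->
  x != q -> x != r -> (x \in u) || (x \in v).
Proof. by rewrite mem_cat !inE => /or4P[->|->|->|->] //; rewrite orbT. Qed.

Lemma prec_swap u v q r x y :
  ~ (x = q /\ y = r) -> ~ (x = r /\ y = q) ->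
  prec (u ++ [:: q, r & v]) x y = prec (u ++ [:: r, q & v]) x y.
Proof.
move=> n1 n2; have [->|nxy] := eqVneq x y; first by rewrite /prec !ltnn.
rewrite -(prec_filter (u ++ _) (p := pred2 x y)) /= ?eqxx ?orbT //.
rewrite -[RHS](prec_filter (p := pred2 x y)) /= ?eqxx ?orbT //.
rewrite !filter_cat /=.
case: (boolP ((q == x) || (q == y))) => // qxy.
case: (boolP ((r == x) || (r == y))) => // rxy.
by case/orP: qxy n1 n2 => /eqP->; case/orP: rxy => /eqP-> // n1 n2;
  [case: n1 | case: n2].
Qed.

End Words.

(** * The twin trees of a word *)

Section Trees.
Implicit Types (s t u v : seq nat) (a b c d q r x y z : nat) (T : tree nat).

Definition bst_of s : tree nat := foldl (fun T a => leaf_insert a T) Leaf s.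

Lemma bst_of_cons x s :
  bst_of (x :: s) =
  Node (bst_of [seq y <- s | y < x]) x (bst_of [seq y <- s | x <= y]).
Proof.
rewrite /bst_of /=; move: Leaf {2 4}Leaf => l r.
by elim: s l r => //= y s IHs l r; case: ltnP => _; rewrite IHs.
Qed.

(** Filtering a word commutes with building its search tree, which turns every
    statement about [bst_of] into an induction on the length of the word. *)
Lemma bst_ind (Q : seq nat -> Prop) :
  Q [::] ->
  (forall x s, Q [seq y <- s | y < x] -> Q [seq y <- s | x <= y] ->
     Q (x :: s)) ->
  forall s, Q s.
Proof.
move=> Q0 Qc s; have [n] := ubnP (size s); elim: n s => // n IHn [|x s] //=.
rewrite ltnS => le; apply: Qc; apply: IHn.
  by apply: leq_ltn_trans le; rewrite size_filter count_size.
by apply: leq_ltn_trans le; rewrite size_filter count_size.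
Qed.

Definition root_bst s : tree nat := foldl (fun T a => root_insert a T) Leaf s.

Lemma root_bst_rcons s x :
  root_bst (rcons s x) = root_insert x (root_bst s).
Proof. by rewrite /root_bst foldl_rcons. Qed.

Lemma lower_lower a x T : lower x (lower a T) = lower (minn a x) T.
Proof.
elim: T => //= l IHl b r IHr; rewrite leq_min.
case: (leqP b a) => //= ba; case: (leqP b x) => //= bx; rewrite ?IHr ?IHl //.
by rewrite (minn_idPr (ltnW (leq_trans bx ba))).
Qed.

Lemma upper_upper a x T : upper x (upper a T) = upper (maxn a x) T.
Proof.
elim: T => //= l IHl b r IHr; rewrite gtn_max.
case: (ltnP a b) => //= ab; case: (ltnP x b) => //= bx; rewrite ?IHr ?IHl //.
by rewrite (maxn_idPr (ltnW (leq_trans ab bx))).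
Qed.

Lemma lower_upper a x T : x <= a -> lower a (upper x T) = upper x (lower a T).
Proof.
move=> xa; elim: T => //= l IHl b r IHr.
case: (ltnP x b) => xb; case: (leqP b a) => ba //=.
- by rewrite ba xb.
- by rewrite leqNgt ba.
- by rewrite ltnNge xb.
by move: xa xb ba; nlia.
Qed.

Lemma lower_root_bst a s :
  lower a (root_bst s) = root_bst [seq y <- s | y <= a].
Proof.
elim/last_ind: s => // s x IHs; rewrite filter_rcons root_bst_rcons /=.
case: (leqP x a) => xa; last first.
  by rewrite -IHs lower_lower (minn_idPr (ltnW xa)).
by rewrite root_bst_rcons -IHs /root_insert lower_upper // lower_lower
  (minn_idPr _).
Qed.

Lemma upper_root_bst a s : upper a (root_bst s) = root_bst [seq y <- s | a < y].
Proof.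
elim/last_ind: s => // s x IHs; rewrite filter_rcons root_bst_rcons /=.
case: (ltnP a x) => xa; last first.
  by rewrite -IHs upper_upper (maxn_idPr xa).
by rewrite root_bst_rcons -IHs /root_insert lower_upper 1?ltnW // upper_upper
  (maxn_idPr (ltnW xa)).
Qed.

(** Root insertions are leaf insertions performed in the opposite order: the
    last letter inserted ends up at the root. *)
Lemma root_bst_rev s : uniq s -> root_bst s = bst_of (rev s).
Proof.
have [n] := ubnP (size s); elim: n s => // n IHn s; case/lastP: s => // s x.
rewrite size_rcons ltnS rcons_uniq => le /andP[xs us].
rewrite root_bst_rcons rev_rcons bst_of_cons /root_insert.
rewrite lower_root_bst upper_root_bst !filter_rev.
have sz p : size (filter p s) < n.
  by apply: leq_ltn_trans le; rewrite size_filter count_size.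
rewrite !IHn ?filter_uniq //.
congr (Node (bst_of (rev _)) _ (bst_of (rev _))); apply: eq_in_filter => y ys.
  by rewrite leq_eqVlt; case: eqP => // e; rewrite -e ys in xs.
by rewrite [RHS]leq_eqVlt; case: eqP => // e; rewrite e ys in xs.
Qed.

Lemma Psymbol_bst s : uniq s ->
  Psymbol s = (forget (bst_of s), forget (bst_of (rev s))).
Proof.
move=> us; rewrite -root_bst_rev // /Psymbol /bst_of /root_bst.
suff -> : forall A B, foldl insert_pair (A, B) s =
   (foldl (fun T a => leaf_insert a T) A s,
    foldl (fun T a => root_insert a T) B s) by [].
by elim: s {us} => //= a s IHs A B; rewrite IHs.
Qed.

Lemma Psymbol_rev s : uniq s ->
  Psymbol (rev s) = ((Psymbol s).2, (Psymbol s).1).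
Proof. by move=> us; rewrite !Psymbol_bst ?rev_uniq // revK. Qed.

Lemma Psymbol_rev_eq s t : uniq s -> uniq t ->
  Psymbol s = Psymbol t -> Psymbol (rev s) = Psymbol (rev t).
Proof. by move=> us ut e; rewrite !Psymbol_rev // e. Qed.

(** If a letter with value between [a] and [d] has been inserted before them,
    then [a] and [d] go to different subtrees of some node, so that the order
    of their insertions is irrelevant. *)
Lemma bst_of_swap u a d v x : x \in u -> a < x < d ->
  bst_of (u ++ [:: a, d & v]) = bst_of (u ++ [:: d, a & v]).
Proof.
have [n] := ubnP (size u); elim: n u v => // n IHn [//|y u] v.
rewrite /= ltnS => le xu /andP[ax xd]; rewrite !bst_of_cons !filter_cat /=.
have sz p : size (filter p u) < n.
  by apply: leq_ltn_trans le; rewrite size_filter count_size.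
have side (p : pred nat) : x != y -> p x -> x \in filter p u.
  by move=> nxy px; rewrite mem_filter px; move: xu; rewrite inE (negbTE nxy).
case: (ltnP a y) => ay; case: (ltnP d y) => dy //=; congr Node.
- by apply: IHn; rewrite ?sz ?ax // side //; nlia.
- by apply: IHn; rewrite ?sz ?ax // side //; nlia.
Qed.

Lemma Psymbol_swap u a d v x y :
  uniq (u ++ [:: a, d & v]) -> x \in u -> a < x < d -> y \in v -> a < y < d ->
  Psymbol (u ++ [:: a, d & v]) = Psymbol (u ++ [:: d, a & v]).
Proof.
move=> us xu ax yv ay; have us' : uniq (u ++ [:: d, a & v]).
  move: us; rewrite !cat_uniq /= !inE !negb_or (eq_sym d) -!andbA.
  by case/and5P=> -> -> -> -> /and4P[-> -> -> ->].
rewrite !Psymbol_bst // (bst_of_swap v xu ax) !rev_cat !rev_cons -!cats1 -!catA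
  /=.
by rewrite -(@bst_of_swap (rev v) a d _ y) ?mem_rev.
Qed.

Lemma inorder_bst_of s : uniq s ->
  bst (bst_of s) /\ perm_eq (inorder (bst_of s)) s.
Proof.
elim/bst_ind: s => // x s IHl IHr /= /andP[xs us].
have [bl pl] := IHl (filter_uniq _ us); have [br pr] := IHr (filter_uniq _ us).
rewrite bst_of_cons bst_Node bl br /= !andbT; split.
  rewrite (perm_all _ pl) (perm_all _ pr) filter_all andTb.
  apply/allP => y; rewrite mem_filter leq_eqVlt => /andP[/orP[/eqP e|//]].
  by rewrite -e (negbTE xs).
rewrite -cat1s perm_catCA /= perm_cons.
rewrite (permPl (perm_cat pl pr)).
by under [X in _ ++ X]eq_filter do rewrite leqNgt; rewrite perm_filterC.
Qed.

Lemma tree_eq_shape T1 T2 :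
  forget T1 = forget T2 -> inorder T1 = inorder T2 -> T1 = T2.
Proof.
have sz T : size (inorder T) = nodes (forget T).
  by elim: T => //= l <- x r <-; rewrite size_cat addnS.
elim: T1 T2 => [|l1 IHl x1 r1 IHr] [|l2 x2 r2] //= [fl fr] /eqP.
rewrite eqseq_cat ?sz ?fl // => /andP[/eqP il]; rewrite eqseq_cons.
by case/andP=> /eqP-> /eqP ir; rewrite (IHl l2) // (IHr r2).
Qed.

Lemma bst_of_shape_inj s t : uniq s -> perm_eq s t ->
  forget (bst_of s) = forget (bst_of t) -> bst_of s = bst_of t.
Proof.
move=> us st fst; have ut : uniq t by rewrite -(perm_uniq st).
have [bs ps] := inorder_bst_of us; have [bt pt] := inorder_bst_of ut.
apply: tree_eq_shape => //; apply: (irr_sorted_eq ltn_trans ltnn bs bt) => x.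
by rewrite (perm_mem ps) (perm_mem pt) (perm_mem st).
Qed.

(** The first letter of a word in an interval of values is the highest node of
    its search tree in that interval. *)
Fixpoint top_between a d T : option nat :=
  if T is Node l b r then
    if b < a then top_between a d r
    else if d < b then top_between a d l else Some b
  else None.

Lemma top_between_bst_of a d s :
  ohead [seq x <- s | a <= x <= d] = top_between a d (bst_of s).
Proof.
elim/bst_ind: s => // x s IHl IHr; rewrite bst_of_cons /=.
rewrite ltnNge; case: (leqP a x) => ax /=; last first.
  rewrite -IHr -filter_predI; congr ohead; apply: eq_filter => y /=.
  by case: (leqP a y) => //= ay; case: (y <= d) => //=;
    rewrite (leq_trans (ltnW ax)).
rewrite ltnNge; case: (leqP x d) => xd //=.
rewrite -IHl -filter_predI; congr ohead; apply: eq_filter => y /=.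
by case: (a <= y) => //=; case: (leqP y d) => //= yd;
  rewrite (leq_ltn_trans yd).
Qed.

Lemma ohead_filterP (p : pred nat) s d : d \in s -> p d ->
  ohead (filter p s) = Some d <->
  (forall x, x \in s -> p x -> x <> d -> prec s d x).
Proof.
elim: s => // h s IHs /=; rewrite inE => ds pd.
case ph: (p h) => /=.
  split=> [[->] x _ _ nx|H].
    by rewrite /prec /= eqxx; case: eqP => [e|//]; case: nx.
  case: (eqVneq h d) => [->//|nhd].
  have := H h (mem_head _ _) ph (elimN eqP nhd).
  by rewrite /prec /= eqxx ltn0.
have nhd : (h == d) = false by apply/eqP => e; rewrite e pd in ph.
rewrite eq_sym nhd /= in ds.
rewrite (IHs ds pd); split=> H x xs px nx.
  have xh : (h == x) = false by apply/eqP => e; rewrite e px in ph.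
  rewrite inE eq_sym xh /= in xs.
  by rewrite /prec /= nhd xh ltnS; apply: H.
have xh : (h == x) = false by apply/eqP => e; rewrite e px in ph.
have := H x; rewrite inE xs orbT /prec /= nhd xh ltnS; exact.
Qed.

(** The two ways in which one of the trees forces [d] to precede [a], for
    [a < d]: in the first case [d] is an ancestor of [a] in the left tree, in
    the second case [a] is an ancestor of [d] in the right tree. *)
Definition forced s a d : Prop :=
  (forall x, x \in s -> a <= x < d -> prec s d x) \/
  (forall x, x \in s -> a < x <= d -> prec s x a).

Lemma first_class s t a d z : uniq s -> perm_eq s t -> z \in s -> a <= z <= d ->
  forget (bst_of s) = forget (bst_of t) ->
  (forall x, x \in s -> a <= x <= d -> x <> z -> prec s z x) ->
  (forall x, x \in t -> a <= x <= d -> x <> z -> prec t z x).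
Proof.
move=> us st zs azd f.
have zt : z \in t by rewrite -(perm_mem st).
move=> /(ohead_filterP (p := fun x => a <= x <= d) zs azd) H.
apply/(ohead_filterP (p := fun x => a <= x <= d) zt azd).
by rewrite top_between_bst_of -(bst_of_shape_inj us st f) -top_between_bst_of.
Qed.

(** The trees have no labels, but their labels can be restored, being
    increasing from left to right; then the first and the last letter in an
    interval of values are read off the left and the right tree. *)
Lemma forced_class s t a d : uniq s -> perm_eq s t -> a \in s -> d \in s ->
  a < d -> Psymbol s = Psymbol t -> forced s a d -> forced t a d.
Proof.
move=> us st sa sd ad; have ut : uniq t by rewrite -(perm_uniq st).
rewrite !Psymbol_bst // => -[fl fr].
have mst := perm_mem st.
case=> H; [left|right] => x xt /andP[ax xd].
  apply: (@first_class s t a d d) => // [|y ys /andP[ay yd] nyd||].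
  - by rewrite leqnn ltnW.
  - by apply: H => //; rewrite ay ltn_neqAle yd andbT; apply/eqP.
  - by rewrite ax ltnW.
  - by move=> e; rewrite e ltnn in xd.
have str : perm_eq (rev s) (rev t)
  by rewrite perm_rev perm_sym perm_rev perm_sym.
have usr : uniq (rev s) by rewrite rev_uniq.
rewrite -prec_rev // -?mst //.
apply: (@first_class (rev s) (rev t) a d a) => // [||y ys /andP[ay yd] nya|||].
- by rewrite mem_rev.
- by rewrite leqnn ltnW.
- rewrite mem_rev in ys; rewrite prec_rev //; apply: H => //.
  by rewrite yd andbT ltn_neqAle ay andbT eq_sym; apply/eqP.
- by rewrite mem_rev.
- by rewrite ltnW.
- by move=> e; rewrite e ltnn in ax.
Qed.

Lemma forced_prec s a d : a \in s -> d \in s -> a < d ->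
  forced s a d -> prec s d a.
Proof. by move=> sa sd ad [] H; apply: H => //; rewrite leqnn ad. Qed.

(** The leaf between the consecutive labels [i] and [i + 1] hangs below the
    one that was inserted last, on the left of [i + 1] or on the right of [i].
    As the right tree is built from the reversed word, this makes the trees
    twins. *)
Lemma leaves_bst_of s m n o : perm_eq s (iota m n.+1) ->
  leaves o (bst_of s) =
  true :: rcons [seq prec s i i.+1 | i <- iota m n] false.
Proof.
elim/bst_ind: s m n o => [|x s IHl IHr] m n o pm.
  by move/perm_size: pm.
have us : uniq (x :: s) by rewrite (perm_uniq pm) iota_uniq.
have mem_s y : (y \in x :: s) = (m <= y < m + n.+1)
  by rewrite (perm_mem pm) mem_iota.
have xm : m <= x < m + n.+1 by rewrite -mem_s mem_head.
have [xs {}us] : x \notin s /\ uniq s by move: us; case/andP.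
have mem_s' y : (y \in s) = (y != x) && (m <= y < m + n.+1).
  have := mem_s y; rewrite inE; case: eqP => [->|_] //=; by rewrite (negbTE xs).
have pl : perm_eq [seq y <- s | y < x] (iota m (x - m)).
  apply: uniq_perm; rewrite ?filter_uniq ?iota_uniq // => y.
  by rewrite mem_filter mem_s' mem_iota; nlia.
have pr : perm_eq [seq y <- s | x <= y] (iota x.+1 (m + n - x)).
  apply: uniq_perm; rewrite ?filter_uniq ?iota_uniq // => y.
  by rewrite mem_filter mem_s' mem_iota; nlia.
rewrite bst_of_cons /=.
have -> : leaves true (bst_of [seq y <- s | y < x]) =
    true :: [seq prec (x :: s) i i.+1 | i <- iota m (x - m)].
  case e: (x - m) pl => [|k] pl.
    by rewrite (nilP (_ : nilp [seq y <- s | y < x])) // /nilp (perm_size pl).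
  rewrite (IHl m k) // -[k.+1]addn1 iotaD map_cat cats1 /=;
    congr (_ :: rcons _ _).
    apply/eq_in_map => i; rewrite mem_iota => im.
    rewrite prec_filter; try nlia.
    by rewrite /prec /= !ifN ?ltnS //; apply/eqP; nlia.
  by rewrite /prec /= (_ : (m + k).+1 = x) ?eqxx ?ltn0 //; nlia.
have -> : leaves false (bst_of [seq y <- s | x <= y]) =
    rcons [seq prec (x :: s) i i.+1 | i <- iota x (m + n - x)] false.
  case e: (m + n - x) pr => [|k] pr.
    by rewrite (nilP (_ : nilp [seq y <- s | x <= y])) // /nilp (perm_size pr).
  rewrite (IHr x.+1 k) //=; congr (_ :: rcons _ _).
    by rewrite /prec /= eqxx ifN //; apply/eqP; nlia.
  apply/eq_in_map => i; rewrite mem_iota => im.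
  rewrite prec_filter; try nlia.
  by rewrite /prec /= !ifN ?ltnS //; apply/eqP; nlia.
rewrite /= -rcons_cat -map_cat; congr (_ :: rcons (map _ _) _).
have {2}-> : x = m + (x - m) by nlia.
by rewrite -iotaD; congr iota; nlia.
Qed.

Lemma twin_Psymbol (s : perm_word) : twin (Psymbol s).
Proof.
have ps : perm_eq s (iota 1 (size s)) by case: s.
have us : uniq s by rewrite (perm_uniq ps) iota_uniq.
have pr : perm_eq (rev s) (iota 1 (size s)) by rewrite perm_rev.
have nf (t : seq nat) : perm_eq t (iota 1 (size s)) -> nodes (bst_of t) = size
  s.
  move=> pt; have ut : uniq t by rewrite (perm_uniq pt) iota_uniq.
  have sz T : size (inorder T) = nodes T.
    by elim: T => //= l <- x r <-; rewrite size_cat addnS.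
  have [_ /perm_size] := inorder_bst_of ut.
  by rewrite sz (perm_size pt) size_iota.
have lf T o : leaves o (forget T) = leaves o T :> seq bool.
  by elim: T o => //= l IHl x r IHr o; rewrite IHl IHr.
rewrite Psymbol_bst // /twin /= !nodes_forget !nf // eqxx /=.
apply/forallP => -[i /= il].
case: (size s) (erefl (size s)) ps pr il => // n en ps pr /= il.
rewrite /canopy !lf !(@leaves_bst_of _ 1 n) //.
have can (f : nat -> bool) :
  nth false (if rcons [seq f i | i <- iota 1 n] false is o :: w
             then belast o w else [::]) i = f i.+1.
  have : nth false [seq f i | i <- iota 1 n] i = f i.+1.
    by rewrite (nth_map 0) ?size_iota // nth_iota.
  by case: n {en ps pr} il => // k _ <- /=; rewrite belast_rcons.
rewrite !can.
have mem y : (y \in (s : seq nat)) = (1 <= y < n.+2).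
  by rewrite (perm_mem ps) mem_iota.
rewrite prec_rev ?mem //=; try nlia.
case: (@prec_total s i.+1 i.+2); rewrite ?mem; try nlia.
  by move=> h; rewrite h; move: h; rewrite /prec; case: ltngtP.
by move=> h; rewrite h; move: h; rewrite /prec; case: ltngtP.
Qed.

End Trees.

(** * Permutations as words *)

Section PermWord.
Implicit Types (s t : perm_word) (w : seq nat).

Lemma perm_wordP s : perm_eq s (iota 1 (size s)). Proof. by case: s. Qed.

Lemma uniq_perm_word s : uniq s.
Proof. by rewrite (perm_uniq (perm_wordP s)) iota_uniq. Qed.

Lemma mem_perm_word s x : (x \in word s) = (0 < x <= size s).
Proof. by rewrite (perm_mem (perm_wordP s)) mem_iota; nlia. Qed.

Lemma perm_word_of s w : perm_eq w s -> exists t, word t = w.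
Proof.
move=> ws; suff h : perm_eq w (iota 1 (size w)) by exists (PermWord h).
by rewrite (perm_size ws) (perm_trans ws) // perm_wordP.
Qed.

Lemma perm_eq_word s t : size s = size t -> perm_eq s t.
Proof.
by move=> e; rewrite (perm_trans (perm_wordP s)) // e perm_sym perm_wordP.
Qed.

Lemma size_Psymbol s t : Psymbol s = Psymbol t -> size s = size t.
Proof. by move=> e; rewrite -!nodes_Psymbol e. Qed.

End PermWord.

(** * The permutohedron order *)

Section WeakOrder.
Implicit Types (s t u v : seq nat) (a b c d q r x y z : nat).

Lemma prec_mem s x y : prec s x y -> x \in s.
Proof.
by rewrite /prec -index_mem => /leq_trans; apply; rewrite index_size.
Qed.

Lemma prec_trans s x y z : prec s x y -> prec s y z -> prec s x z.
Proof. exact: ltn_trans. Qed.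

Lemma prec_asym s x y : prec s x y -> prec s y x -> False.
Proof. by rewrite /prec; case: ltngtP. Qed.

Lemma prec_irr s x : prec s x x -> False.
Proof. by rewrite /prec ltnn. Qed.

Definition inv_le s t : Prop := forall a d, a < d -> prec s d a -> prec t d a.

Lemma inv_leI s t : perm_eq s t ->
  (forall a d, a \in s -> d \in s -> a < d -> prec s d a -> prec t d a) ->
  inv_le s t.
Proof.
move=> st H a d ad sda; have ds := prec_mem sda.
case: (boolP (a \in s)) => [sa|sa]; first exact: H.
rewrite /prec [X in _ < X]memNindex -?(perm_mem st) //.
by rewrite index_mem -(perm_mem st).
Qed.

Lemma inv_le_trans s t u : inv_le s t -> inv_le t u -> inv_le s u.
Proof. by move=> st tu a d ad /(st _ _ ad) /(tu _ _ ad). Qed.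

Lemma word_prec_inj s t : uniq s -> perm_eq s t ->
  (forall x y, x \in s -> y \in s -> prec s x y -> prec t x y) -> s = t.
Proof.
elim: s t => [|x s IHs] [|y t] //=.
- by move=> _ /perm_size.
- by move=> _ /perm_size.
move=> /andP[xs us] st H.
have exy : x = y.
  apply/eqP/negPn/negP => nxy.
  have ys : y \in x :: s by rewrite (perm_mem st) mem_head.
  have := H x y (mem_head _ _) ys.
  by rewrite /prec /= eqxx (negbTE nxy) => /(_ isT); rewrite eqxx ltn0.
subst y; congr cons; rewrite perm_cons in st; apply: IHs => // a b as_ bs sab.
have na c : c \in s -> (x == c) = false.
  by move=> cs; apply/eqP => e; rewrite e cs in xs.
have := H a b; rewrite !inE as_ bs !orbT /prec /= !na // !ltnS.
by apply.
Qed.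

Lemma inv_le_anti s t : uniq s -> perm_eq s t -> inv_le s t -> inv_le t s ->
  s = t.
Proof.
move=> us st le1 le2; apply: word_prec_inj => // x y xs ys sxy.
have xt : x \in t by rewrite -(perm_mem st).
case: (ltngtP x y) => xy; last by rewrite xy in sxy; case: (prec_irr sxy).
  case: (@prec_total t x y xt) => //; first by move=> e; rewrite e ltnn in xy.
  by move/(le2 _ _ xy)/(prec_asym sxy).
exact: le1.
Qed.

Lemma perm_swap u v q r : perm_eq (u ++ [:: q, r & v]) (u ++ [:: r, q & v]).
Proof. by rewrite perm_cat2l (perm_catCA [:: q] [:: r] v). Qed.

Lemma prec_adjacent u v q r : uniq (u ++ [:: q, r & v]) ->
  prec (u ++ [:: q, r & v]) q r.
Proof. by case/split_adjacent => e1 e2 _ _; rewrite /prec e1 e2. Qed.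

Lemma prec_cover u v a d x y : uniq (u ++ [:: a, d & v]) -> a < d ->
  x < y -> prec (u ++ [:: d, a & v]) y x =
  ((x == a) && (y == d)) || prec (u ++ [:: a, d & v]) y x.
Proof.
move=> us ad xy; case: eqP => [->|nx] /=.
  case: eqP => [->|ny] /=.
    by apply: prec_adjacent; rewrite (perm_uniq (perm_swap _ _ _ _)).
  by apply: prec_swap => -[e1 e2]; [case: ny | rewrite -e2 ltnn in ad].
apply: prec_swap => -[e1 e2] //; subst.
by move: (ltn_trans ad xy); rewrite ltnn.
Qed.

Lemma inv_le_cover u v a d : uniq (u ++ [:: a, d & v]) -> a < d ->
  inv_le (u ++ [:: a, d & v]) (u ++ [:: d, a & v]).
Proof.
by move=> us ad x y xy h; rewrite prec_cover // h orbT.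
Qed.

Definition inversions s :=
  #|[pred p : 'I_(size s).+1 * 'I_(size s).+1 | p.1 < p.2 & prec s p.2 p.1]|.

Lemma inversions_lt (s t : perm_word) : size s = size t -> inv_le s t ->
  word s <> t -> inversions s < inversions t.
Proof.
move=> sz le ne; rewrite /inversions -sz; apply: proper_card; apply/properP;
  split.
  by apply/fintype.subsetP => -[a d];
    rewrite !inE /= => /andP[ad /(le _ _ ad) ->]; rewrite ad.
apply: contrapT => H; apply: ne; apply: inv_le_anti => //.
- exact: uniq_perm_word.
- exact: perm_eq_word.
have st := perm_eq_word sz.
apply: inv_leI => [|a d at_ dt ad tda]; first by rewrite perm_sym.
rewrite -(perm_mem st) mem_perm_word in at_;
  rewrite -(perm_mem st) mem_perm_word in dt.
apply/negPn/negP => nsda; apply: H.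
have la : a < (size s).+1 by nlia.
have ld : d < (size s).+1 by nlia.
exists (Ordinal la, Ordinal ld).
  by rewrite inE /= ad.
by rewrite inE /= ad.
Qed.

(** If all neighbours of [s] were ordered as in [t], then [s] would be equal
    to [t]; two neighbours that are not form an ascent since [t] has all the
    inversions of [s]. *)
Lemma inv_le_ascent s t : uniq s -> perm_eq s t -> inv_le s t -> s <> t ->
  exists u v a d, [/\ s = u ++ [:: a, d & v], a < d & prec t d a].
Proof.
move=> us st le ne; apply: contrapT => H; apply: ne.
apply: word_prec_inj => // x y xs ys sxy; apply/negPn/negP => ntxy.
have xt : x \in t by rewrite -(perm_mem st).
have nxy : x <> y by move=> e; rewrite e in sxy; case: (prec_irr sxy).
have tyx : prec t y x by case: (prec_total xt nxy) => // h; rewrite h in ntxy.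
have [|q [r [qs rs tq tr [qr _ _]]]] :=
  @crossing (fun z => index y t < index z t) s x y us xs ys sxy tyx.
  by rewrite ltnn.
have [u [v [e _ _]]] := adjacent_split us qs rs qr.
have trq : prec t r q by rewrite /prec; move: tq tr; nlia.
have sqr : prec s q r by rewrite /prec qr.
apply: H; exists u, v, q, r; split=> //.
case: (ltngtP q r) => // h; last by rewrite h in sqr; case: (prec_irr sqr).
by case: (prec_asym trq (le _ _ h sqr)).
Qed.

(** The permutohedron order is the inclusion of inversion sets: as long as the
    inclusion is strict, some ascent of [s] can be inverted without leaving
    the inversions of [t]. *)
Lemma perm_leP (s t : perm_word) :
  perm_le s t <-> size s = size t /\ inv_le s t.
Proof.
split=> [st|].
  split; first exact: perm_le_size.
  elim: st => {s t} [s t [u [v [a [b [ab es et]]]]]|s a d//|s t r _ st _ tr].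
    by rewrite es et; apply: inv_le_cover => //; rewrite -es uniq_perm_word.
  exact: inv_le_trans tr.
have [n] := ubnP (inversions t - inversions s); elim: n s => // n IHn s;
  rewrite ltnS => le_n.
case=> sz le; have [/val_inj->|ne] := eqVneq (word s) (word t).
  exact: rt_refl.
have us := uniq_perm_word s.
have [u [v [a [d [es ad tda]]]]] := inv_le_ascent us (perm_eq_word sz) le
  (elimN eqP ne).
have [|s' es'] := @perm_word_of s (u ++ [:: d, a & v]).
  by rewrite es perm_swap.
have cov : perm_cover s s' by exists u, v, a, d.
have sz' : size s' = size s by rewrite es es' !size_cat.
rewrite es in us.
have le' : inv_le s' t.
  move=> x y xy; rewrite es' prec_cover // -es =>
    /orP[/andP[/eqP-> /eqP->] //|].
  exact: le.
have lt1 : inversions s < inversions s'.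
  apply: inversions_lt => //; first by rewrite es es'; apply: inv_le_cover.
  rewrite es es' => /eqP; rewrite eqseq_cat // eqxx /= => /eqP[e _].
  by rewrite e ltnn in ad.
have lt2 : inversions s < inversions t by apply: inversions_lt => //; apply/eqP.
apply: rt_trans (rt_step _ _ _ _ cov) (IHn s' _ _); last by rewrite sz'.
by nlia.
Qed.

(** * Minimal elements of the classes *)

(** No descent [d a] can be replaced by [a d] by means of [Psymbol_swap]. *)
Definition reduced s : Prop := forall u v d a x y, s = u ++ [:: d, a & v] ->
  x \in u -> y \in v -> a < x < d -> a < y < d -> False.

(** The letters that [d] precedes in the first case of [forced] are smaller
    than [d], and those that precede [a] in the second case are larger than
    [a]: all the pairs concerned are inversions. *)
Lemma forced_mono s t a d : perm_eq s t -> inv_le s t ->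
  forced s a d -> forced t a d.
Proof.
move=> st le [] H; [left|right] => x; rewrite -(perm_mem st) => xs /andP[ax xd].
  by apply: le => //; apply: H; rewrite ?ax.
by apply: le => //; apply: H; rewrite ?ax.
Qed.

(** An inversion [d..a] with an intermediate value between [d] and [a] follows
    by transitivity; otherwise the two letters where the word drops from
    values [>= d] to values [<= a] form a descent; as [s] is reduced, [d] is
    the first or [a] the last letter among the values from [a] to [d]. *)
Lemma reduced_inv_le s t : uniq s -> perm_eq s t -> reduced s ->
  (forall a d, a \in s -> d \in s -> a < d -> forced s a d -> prec t d a) ->
  inv_le s t.
Proof.
move=> us st irs H; apply: inv_leI => // a d sa sd.
have [n] := ubnP (index a s - index d s);
  elim: n a d sa sd => // n IHn a d sa sd.
rewrite ltnS => le_n ad sda.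
have [[x [sx ax xd sdx sxa]]|nx] :=
  pselect (exists x, [/\ x \in s, a < x, x < d, prec s d x & prec s x a]).
  apply: (@prec_trans _ _ x); apply: IHn => //.
    by move: le_n sdx sxa; rewrite /prec; nlia.
  by move: le_n sdx sxa; rewrite /prec; nlia.
have [||q [r [sq sr dq]]] := @crossing (fun z => d <= z) s d a us sd sa sda.
- exact: leqnn.
- by rewrite -ltnNge.
rewrite -ltnNge => rd [qr iq ir].
have sqr : prec s q r by rewrite /prec qr.
have ra : r <= a.
  rewrite leqNgt; apply/negP => ar; apply: nx; exists r; split=> //.
    by rewrite /prec qr.
  rewrite /prec ltn_neqAle ir andbT; apply/eqP => /(index_inj_mem sr) e.
  by rewrite e ltnn in ar.
have rq : r < q by nlia.
have [u [v [es inu inw]]] := adjacent_split us sq sr qr.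
apply: H => //.
have [[x xu rxq]|nox] := pselect (exists2 x, x \in u & r < x < q).
  have noy y : y \in s -> r < y < q -> prec s y r.
    move=> ys /andP[ry yq]; case: (@prec_total s y r ys) => // [e|h].
      by rewrite e ltnn in ry.
    by case: (irs _ _ _ _ x y es) => //; [exact: inw | rewrite ry].
  have ear : a = r.
    case: (ltngtP r a) ra => // ra _.
    have := noy a sa; rewrite ra (leq_trans ad dq) => /(_ isT).
    by rewrite /prec ltnNge ir.
  subst r; right => y ys /andP[ay yd].
  have [->//|nyq] := eqVneq y q.
  by apply: noy => //; rewrite ay ltn_neqAle nyq (leq_trans yd dq).
have nou x : x \in s -> r < x < q -> prec s q x.
  move=> xs /andP[rx xq]; case: (@prec_total s x q xs) => // [e|h].
    by rewrite e ltnn in xq.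
  by case: nox; exists x; [exact: inu | rewrite rx].
have edq : d = q.
  case: (ltngtP d q) dq => // dq _.
  have := nou d sd; rewrite dq (leq_ltn_trans ra ad) => /(_ isT).
  by rewrite /prec ltnNge iq.
subst q; left => y ys /andP[ay yd].
have [->//|nyr] := eqVneq y r.
by apply: nou => //; rewrite yd andbT ltn_neqAle eq_sym nyr (leq_trans ra ay).
Qed.

Lemma exists_reduced (s : perm_word) :
  exists t : perm_word, reduced t /\ Psymbol t = Psymbol s.
Proof.
have [n] := ubnP (inversions s); elim: n s => // n IHn s; rewrite ltnS => le_n.
have [irs|nirs] := pselect (reduced s); first by exists s.
have [u [v [d [a [x [y [es xu yv axd ayd]]]]]]] : exists u v d a x y,
    [/\ word s = u ++ [:: d, a & v], x \in u, y \in v, a < x < d & a < y < d].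
  apply: contrapT => H; apply: nirs => u v d a x y *; apply: H.
  by exists u, v, d, a, x, y.
have us := uniq_perm_word s.
have [|s' es'] := @perm_word_of s (u ++ [:: a, d & v]).
  by rewrite es perm_swap.
have us' := uniq_perm_word s'; rewrite es' in us'.
have ad : a < d by nlia.
have [|t [it et]] := IHn s'.
  apply: leq_trans le_n; apply: inversions_lt.
  - by rewrite es es' !size_cat.
  - by rewrite es es'; apply: inv_le_cover.
  rewrite es es' => /eqP; rewrite eqseq_cat // eqxx /= => /eqP[e _].
  by rewrite e ltnn in ad.
exists t; split=> //; rewrite et es es'.
exact: Psymbol_swap us' xu axd yv ayd.
Qed.

(** Forced inversions depend on the class only and can only increase along the
    permutohedron order, so that those of [s] are inversions of [t]. *)
Lemma reduced_le_class (s s' t' t : perm_word) : reduced s ->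
  Psymbol s' = Psymbol s -> perm_le s' t' -> Psymbol t' = Psymbol t ->
  perm_le s t.
Proof.
move=> irs ess /perm_leP[sz le] ett.
have sz1 := size_Psymbol ess; have sz2 := size_Psymbol ett.
have st : size s = size t by rewrite -sz1 sz.
apply/perm_leP; split=> //; apply: reduced_inv_le => //.
- exact: uniq_perm_word.
- exact: perm_eq_word.
move=> a d sa sd ad /(forced_class (uniq_perm_word s) (perm_eq_word (esym sz1))
  sa sd ad (esym ess)).
move=> /(forced_mono (perm_eq_word sz) le).
have sub (r1 r2 : perm_word) x : size r1 = size r2 -> x \in word r1 ->
  x \in word r2.
  by move=> e; rewrite (perm_mem (perm_eq_word e)).
have ta x : x \in word s -> x \in word t by apply: sub.
have ta' x : x \in word s -> x \in word t' by apply: sub; rewrite -sz1.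
move=> /(forced_class (uniq_perm_word t') (perm_eq_word sz2) (ta' _ sa)
  (ta' _ sd) ad ett).
by apply: forced_prec => //; apply: ta.
Qed.

Lemma reduced_class_inj (s t : perm_word) :
  reduced s -> reduced t -> Psymbol s = Psymbol t -> s = t.
Proof.
move=> irs irt e.
have /perm_leP[sz le1] : perm_le s t
  by apply: (reduced_le_class irs _ (rt_refl _ _ s)).
have /perm_leP[_ le2] : perm_le t s
  by apply: (reduced_le_class irt _ (rt_refl _ _ t)).
apply: val_inj; apply: inv_le_anti => //; first exact: uniq_perm_word.
exact: perm_eq_word.
Qed.

End WeakOrder.

(** * Existence of Baxter permutations *)

Section BaxterPermutations.
Implicit Types (s t u v : seq nat) (a b c d q r x y z : nat).

Definition unseparated s a d : Prop := forall x, x \in s -> a < x < d ->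
  (prec s x a /\ prec s x d) \/ (prec s a x /\ prec s d x).

(** An unseparated pair whose order creates a pattern 3-14-2 or 2-41-3, up to
    the letters [<= a] and [>= d] that may occur between [a] and [d].  Letting
    the pair be non-adjacent makes the notion depend only on the relative
    order of the letters with values from [a] to [d]. *)
Definition misplaced s a d : Prop :=
  [/\ a < d, a \in s, d \in s & unseparated s a d] /\
  exists x y, [/\ x \in s, y \in s, a < x < d & a < y < d] /\
  ([/\ prec s a d, y < x, prec s x a & prec s d y] \/
   [/\ prec s d a, x < y, prec s x d & prec s a y]).

Definition well_placed k s : Prop := forall a d, d < a + k -> ~ misplaced s a d.

Lemma unseparated_rev s a d : uniq s -> a \in s -> d \in s ->
  unseparated s a d -> unseparated (rev s) a d.
Proof.
move=> us sa sd ns x; rewrite mem_rev => sx axd; rewrite !prec_rev //.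
by case: (ns x sx axd); [right|left].
Qed.

Lemma misplaced_rev s a d :
  uniq s -> misplaced s a d -> misplaced (rev s) a d.
Proof.
move=> us [[ad sa sd ns] [x [y [[sx sy ax ay] H]]]].
split; first by split; rewrite ?mem_rev //; apply: unseparated_rev.
exists y, x; split; first by split; rewrite ?mem_rev.
rewrite !prec_rev //.
by case: H => -[h1 h2 h3 h4]; [right|left].
Qed.

Lemma well_placed_rev k s : uniq s -> well_placed k s -> well_placed k (rev s).
Proof.
move=> us nb a d ad b; apply: (nb a d ad); rewrite -(revK s).
by apply: misplaced_rev; rewrite ?rev_uniq.
Qed.

Lemma filter_unseparated s (p : pred nat) q r :
  uniq s -> q \in filter p s -> r \in filter p s ->
  index r (filter p s) = (index q (filter p s)).+1 ->
  (forall x, minn q r < x < maxn q r -> p x) ->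
  prec s q r /\ unseparated s (minn q r) (maxn q r).
Proof.
move=> us qs rs e px; have [pq pr] : p q /\ p r.
  by move: qs rs; rewrite !mem_filter => /andP[-> _] /andP[-> _].
have sqr : prec s q r by rewrite -(prec_filter s pq pr) /prec e.
split=> // x xs h.
suff : (prec s x q /\ prec s x r) \/ (prec s q x /\ prec s r x).
  by case: (leqP q r) => // _ [[]|[]]; [left|right].
have {}px := px x h.
have xf : x \in filter p s by rewrite mem_filter px.
case: (ltngtP (index x (filter p s)) (index q (filter p s))) => xq.
- left; have sxq : prec s x q by rewrite -(prec_filter s px pq).
  by split=> //; apply: prec_trans sqr.
- right; have sqx : prec s q x by rewrite -(prec_filter s pq px).
  split=> //; rewrite -(prec_filter s pr px) /prec e ltn_neqAle xq andbT.
  rewrite -e; apply/eqP => /(index_inj_mem rs) erx; move: h; rewrite -erx.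
  by clear; nlia.
- move: h; rewrite (index_inj_mem xf xq); clear; nlia.
Qed.

(** Take [x1] and [x2] to be the values closest to [y] among those before [a]
    and [d].  Then no value before [a] and [d] lies strictly between [x1] and
    [x2], so that a jump over [y] is a jump over both, and [y] together with
    [x1] or [x2] makes the pair of its endpoints misplaced, with a smaller
    difference. *)
Lemma straddle s a d x1 x2 y : uniq s -> well_placed (d - a) s ->
  a \in s -> d \in s -> unseparated s a d -> y \in s -> prec s a y -> prec s d
    y ->
  x1 \in s -> x2 \in s -> prec s x1 a -> prec s x2 a ->
  a < x1 -> x1 < y -> y < x2 -> x2 < d -> False.
Proof.
move=> us nb sa sd ns sy ay dy sx1 sx2 x1a x2a ax1 x1y yx2 x2d.
pose X x := [&& x \in s, a < x, x < d & prec s x a].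
have Xd x : X x -> prec s x d.
  case/and4P=> sx ax xd xa; case: (ns x sx) => [|[]//|[h _]].
    by rewrite ax xd.
  by case: (prec_asym h xa).
have inX x : x \in s -> a < x < d -> prec s x a \/ prec s x d -> X x.
  move=> sx axd h; rewrite /X sx; case/andP: (axd) => -> -> /=.
  case: (ns x sx axd) => [[]//|[h1 h2]].
  by case: h => h; [case: (prec_asym h h1)|case: (prec_asym h h2)].
have ex1 : exists x, X x && (x < y).
  by exists x1; rewrite /X sx1 ax1 x1a (ltn_trans x1y) // (ltn_trans yx2).
have ub x : X x && (x < y) -> x <= y by case/andP=> _ /ltnW.
have {sx1 x1a ax1 x1y x1} [x1 /andP[Xx1 x1y] x1max] := ex_maxnP ex1 ub.
have ex2 : exists x, X x && (y < x).
  by exists x2; rewrite /X sx2 x2a x2d yx2 (ltn_trans (ltn_trans _ x1y)) //;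
    case/and4P: Xx1.
have {sx2 x2a x2d yx2 x2} [x2 /andP[Xx2 yx2] x2min] := ex_minnP ex2.
have [sx1 ax1 x1d x1a] := and4P Xx1.
have [sx2 ax2 x2d x2a] := and4P Xx2.
have [[x3 [Xx3 yx3 x13]]|no] := pselect
  (exists x3, [/\ X x3, y < x3 & prec s x1 x3]).
  (* On the way from [x3] to [a], the values in [a, d) drop from above [y] to
     below [x1]: maximality of [x1] excludes landing between [x1] and [y]. *)
  have [sx3 ax3 x3d x3a] := and4P Xx3.
  pose p z := (a <= z) && (z < d).
  have pa : p a by rewrite /p leqnn (ltn_trans ax1).
  have px3 : p x3 by rewrite /p x3d ltnW.
  have [||||||q [r [qs rs yq ry [e iq ir]]]] :=
    @crossing (fun z => y < z) (filter p s) x3 a.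
  - by rewrite filter_uniq.
  - by rewrite mem_filter px3.
  - by rewrite mem_filter pa.
  - by rewrite prec_filter.
  - by [].
  - by rewrite -leqNgt (ltnW (ltn_trans ax1 x1y)).
  rewrite -leqNgt in ry.
  have [/andP[aq qd] sq] : p q /\ q \in s
    by move: qs; rewrite mem_filter => /andP.
  have [/andP[ar rd] sr] : p r /\ r \in s
    by move: rs; rewrite mem_filter => /andP.
  have pq : p q by rewrite /p aq.
  have pr : p r by rewrite /p ar.
  have rq : r < q := leq_ltn_trans ry yq.
  have [sqr] : prec s q r /\ unseparated s (minn q r) (maxn q r).
    apply: (filter_unseparated us qs rs e) => z; rewrite /p.
    by move: ar qd aq rd; clear; nlia.
  rewrite (minn_idPr (ltnW rq)) (maxn_idPl (ltnW rq)) => nsqr.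
  have x1q : prec s x1 q.
    have [->//|nq3] := eqVneq q x3; apply: prec_trans x13 _.
    rewrite -(prec_filter s px3 pq) /prec ltn_neqAle iq andbT.
    apply/eqP => /index_inj_mem -/(_ (etrans (mem_filter _ _ _) _)) e3.
    by rewrite e3 ?eqxx // px3 in nq3.
  have ray : prec s r y.
    have [->//|nra] := eqVneq r a; apply: prec_trans ay.
    rewrite -(prec_filter s pr pa) /prec ltn_neqAle ir andbT.
    by apply/eqP => /(index_inj_mem rs) e3; rewrite e3 eqxx in nra.
  have nry : r != y by apply/eqP => e3; rewrite e3 in ray; case: (prec_irr ray).
  have rx1 : r < x1.
    rewrite ltn_neqAle; apply/andP; split.
      apply/eqP => e3; rewrite e3 in sqr; case: (prec_asym x1q sqr).
    rewrite leqNgt; apply/negP => x1r.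
    have nra : r != a by move: ax1 x1r; clear; nlia.
    have : X r && (r < y).
      rewrite ltn_neqAle nry ry !andbT; apply: inX => //.
        by rewrite rd (ltn_trans ax1).
      left; rewrite -(prec_filter s pr pa) /prec ltn_neqAle ir andbT.
      by apply/eqP => /(index_inj_mem rs) e3; rewrite e3 eqxx in nra.
    by move/x1max; rewrite leqNgt x1r.
  apply: (nb r q); first by move: ar qd; clear; nlia.
  split; first by split.
  exists x1, y; split; first by split=> //;
    rewrite ?rx1 ?yq ?(ltn_trans x1y) ?(ltn_trans rx1).
  by right.
(* Otherwise [x2] precedes [x1], and the values in (a, d] rise from below [y]
   to above [x2] on the way from [x1] to [d]. *)
have x21 : prec s x2 x1.
  case: (@prec_total s x2 x1) => // [e|h]; last by case: no; exists x2.
  by move: x1y yx2; rewrite e; clear; nlia.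
pose p z := (a < z) && (z <= d).
have pd : p d by rewrite /p leqnn (ltn_trans ax1).
have px1 : p x1 by rewrite /p ax1 ltnW.
have x1d' := Xd _ Xx1.
have [||||||q [r [qs rs qy ry [e iq ir]]]] :=
  @crossing (fun z => z < y) (filter p s) x1 d.
- by rewrite filter_uniq.
- by rewrite mem_filter px1.
- by rewrite mem_filter pd.
- by rewrite prec_filter.
- by [].
- by rewrite -leqNgt (ltnW (ltn_trans yx2 x2d)).
rewrite -leqNgt in ry.
have [/andP[aq qd] sq] : p q /\ q \in s
  by move: qs; rewrite mem_filter => /andP.
have [/andP[ar rd] sr] : p r /\ r \in s
  by move: rs; rewrite mem_filter => /andP.
have pq : p q by rewrite /p aq.
have pr : p r by rewrite /p ar.
have qr : q < r := leq_trans qy ry.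
have [sqr] : prec s q r /\ unseparated s (minn q r) (maxn q r).
  apply: (filter_unseparated us qs rs e) => z; rewrite /p.
  by move: ar qd aq rd; clear; nlia.
rewrite (minn_idPl (ltnW qr)) (maxn_idPr (ltnW qr)) => nsqr.
have x2q : prec s x2 q.
  have [->//|nq3] := eqVneq q x1; apply: prec_trans x21 _.
  rewrite -(prec_filter s px1 pq) /prec ltn_neqAle iq andbT.
  apply/eqP => /esym /(index_inj_mem qs) e3.
  by rewrite e3 eqxx in nq3.
have rdy : prec s r y.
  have [->//|nrd] := eqVneq r d; apply: prec_trans dy.
  rewrite -(prec_filter s pr pd) /prec ltn_neqAle ir andbT.
  by apply/eqP => /(index_inj_mem rs) e3; rewrite e3 eqxx in nrd.
have nry : y != r.
  by apply/eqP => e3; rewrite e3 in rdy; case: (prec_irr rdy).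
have x2r : x2 < r.
  rewrite ltn_neqAle; apply/andP; split.
    by apply/eqP => e3; rewrite e3 in x2q; case: (prec_asym x2q sqr).
  rewrite leqNgt; apply/negP => rx2.
  have nrd : r != d by move: x2d rx2; clear; nlia.
  have : X r && (y < r).
    rewrite ltn_neqAle nry ry !andbT; apply: inX => //.
      by rewrite ar (ltn_trans rx2).
    right; rewrite -(prec_filter s pr pd) /prec ltn_neqAle ir andbT.
    by apply/eqP => /(index_inj_mem rs) e3; rewrite e3 eqxx in nrd.
  by move/x2min; rewrite leqNgt rx2.
apply: (nb q r); first by move: aq rd; clear; nlia.
split; first by split.
exists x2, y; split; first
  by rewrite x2r qy (ltn_trans qy yx2) (ltn_trans yx2 x2r).
by left.
Qed.

(** If both inequalities held, some value on one side of the pair would lie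
    between two values of the other side, against [straddle] for the word or
    for its reversal.
    Hence at most one of the two orders of the pair is misplaced. *)
Lemma straddle_free s a d x1 y1 x2 y2 : uniq s -> well_placed (d - a) s ->
  a \in s -> d \in s -> unseparated s a d ->
  [/\ x1 \in s, a < x1 < d, prec s x1 a & prec s x1 d] ->
  [/\ x2 \in s, a < x2 < d, prec s x2 a & prec s x2 d] ->
  [/\ y1 \in s, a < y1 < d, prec s a y1 & prec s d y1] ->
  [/\ y2 \in s, a < y2 < d, prec s a y2 & prec s d y2] ->
  x1 < y1 -> y2 < x2 -> False.
Proof.
move=> us nb sa sd ns [sx1 /andP[ax1 _] x1a x1d] [sx2 /andP[ax2 x2d] x2a x2d'].
move=> [sy1 /andP[_ y1d] ay1 dy1] [sy2 /andP[ay2 _] ay2' dy2] xy1 yx2.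
case: (ltngtP x2 y1) => h; last 1 first.
- by rewrite h in x2a; case: (prec_asym x2a ay1).
- apply: (@straddle (rev s) a d y2 y1 x2);
    rewrite ?mem_rev ?rev_uniq ?prec_rev //.
  + exact: well_placed_rev.
  + exact: unseparated_rev.
- by apply: (@straddle s a d x1 x2 y1).
Qed.

Lemma Psymbol_bubble pre x u suf a d z w :
  uniq (pre ++ x :: u ++ suf) -> z \in pre -> w \in suf ->
  a < z < d -> a < w < d -> x <= a -> all (fun y => d <= y) u ->
  Psymbol (pre ++ x :: u ++ suf) = Psymbol (pre ++ u ++ x :: suf).
Proof.
move=> us zp ws az aw xa; elim: u pre us zp => //= b u IHu pre us zp
  /andP[db du].
rewrite (Psymbol_swap us zp (y := w)); try by nlia.
  rewrite -cat1s catA IHu -?catA //; last by rewrite mem_cat zp.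
  by rewrite (perm_uniq (perm_swap _ _ _ _)).
by rewrite mem_cat ws orbT.
Qed.

(** The values of [z] and [w] lie between any letter [<= a] and any letter
    [>= d], so that such letters may be exchanged whenever they are adjacent. *)
Lemma Psymbol_sort pre u suf a d z w :
  uniq (pre ++ u ++ suf) -> z \in pre -> w \in suf ->
  a < z < d -> a < w < d -> all (fun x => (x <= a) || (d <= x)) u ->
  Psymbol (pre ++ u ++ suf) =
  Psymbol (pre ++ [seq x <- u | d <= x] ++ [seq x <- u | x <= a] ++ suf).
Proof.
move=> + + ws az aw; elim: u pre => //= x u IHu pre us zp /andP[xad au].
rewrite -cat1s catA (IHu (pre ++ [:: x])) -?catA ?mem_cat ?zp //=.
have ad : a < d by nlia.
case/orP: xad => [xa|dx]; last by rewrite dx ifN // -ltnNge (leq_trans ad).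
rewrite xa ifN -?ltnNge ?(leq_ltn_trans xa) //.
apply: (@Psymbol_bubble pre x _ _ a d z w); rewrite ?mem_cat ?ws ?orbT //.
  rewrite (perm_uniq (_ : perm_eq _ (pre ++ x :: u ++ suf))) //.
  rewrite perm_cat2l perm_cons catA perm_cat2r perm_sym.
  have -> : [seq x <- u | x <= a] = [seq x <- u | ~~ (d <= x)].
    apply: eq_in_filter => y yu; move/allP: au => /(_ y yu).
    by rewrite -ltnNge; move: ad; clear; nlia.
  by rewrite perm_sym perm_filterC.
exact: filter_all.
Qed.

Lemma prec_split u v x y : uniq (u ++ x :: v) ->
  prec (u ++ x :: v) y x = (y \in u).
Proof.
rewrite cat_uniq /= negb_or => /and3P[_ /andP[xu _] _].
rewrite /prec !index_cat (negbTE xu) /= eqxx addn0.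
by case: ifP => yu; [rewrite index_mem | rewrite ltnNge leq_addr].
Qed.

Lemma prec_split_r u v x y : uniq (u ++ x :: v) -> y \in v ->
  prec (u ++ x :: v) x y.
Proof.
move=> us yv; have := us; rewrite cat_uniq /= negb_or.
case/and3P=> _ /andP[_ nv] /andP[xv _].
have yu : y \notin u := hasPn nv y yv.
case: (@prec_total (u ++ x :: v) x y) => //.
- by rewrite mem_cat mem_head orbT.
- by move=> e; rewrite e yv in xv.
- by rewrite prec_split // (negbTE yu).
Qed.

(** The letters from [a] to [d] in [s] are all [<= a] or [>= d]; they may be
    sorted into the letters [>= d] followed by the letters [<= a], which puts
    [d] before [a] and otherwise affects only pairs with a larger difference.
    *)
Lemma misplaced_ascent_fix s a d : uniq s -> misplaced s a d -> prec s a d ->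
  exists t, [/\ perm_eq t s, Psymbol t = Psymbol s, prec t d a &
    forall x y, ~~ ((x <= a) && (d <= y)) -> ~~ ((y <= a) && (d <= x)) ->
      prec t x y = prec s x y].
Proof.
move=> us [[ad sa sd ns] [z [w [[sz sw az aw] H]]]] sad.
have {H} [za dw] : prec s z a /\ prec s d w.
  by case: H => -[h1 h2 h3 h4]; [|case: (prec_asym h1 sad)].
case/splitPr: sa us ns sd sz sw sad za dw => pre r us ns sd sz sw sad za dw.
have dr : d \in r.
  move: sd; rewrite mem_cat inE => /or3P[h|/eqP e|//].
    by move: h; rewrite -(prec_split _ us) => /(prec_asym sad).
  by rewrite e ltnn in ad.
case/splitPr: dr us ns sd sz sw sad za dw => m suf us ns sd sz sw sad za dw.
have zp : z \in pre by rewrite -(prec_split _ us).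
have us2 : uniq ((pre ++ a :: m) ++ d :: suf) by rewrite -catA.
have e2 : pre ++ a :: m ++ d :: suf = (pre ++ a :: m) ++ d :: suf
  by rewrite -catA.
have ws : w \in suf.
  move: sw dw; rewrite e2 mem_cat inE => /or3P[h|/eqP->|//].
    by move: h; rewrite -(prec_split _ us2) => h /(prec_asym h).
  by move/prec_irr.
pose u := a :: m ++ [:: d].
have es : pre ++ a :: m ++ d :: suf = pre ++ u ++ suf by rewrite /u /= -catA.
have mu : all (fun x => (x <= a) || (d <= x)) u.
  apply/allP => x; rewrite /u inE mem_cat inE.
  case/or3P=> [/eqP->|xm|/eqP->]; rewrite ?leqnn ?orbT //.
  apply/negPn/negP; rewrite negb_or -!ltnNge => axd.
  have ax : prec (pre ++ a :: m ++ d :: suf) a x.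
    by apply: prec_split_r => //; rewrite mem_cat xm.
  have xd : prec (pre ++ a :: m ++ d :: suf) x d.
    by rewrite e2 prec_split // mem_cat inE xm !orbT.
  have xs : x \in pre ++ a :: m ++ d :: suf by apply: prec_mem xd.
  by case: (ns x xs axd) => -[h1 h2];
    [apply: prec_asym h1 ax|apply: prec_asym xd h2].
rewrite es in us *.
exists (pre ++ [seq x <- u | d <= x] ++ [seq x <- u | x <= a] ++ suf).
have pt : perm_eq ([seq x <- u | d <= x] ++ [seq x <- u | x <= a]) u.
  have -> : [seq x <- u | x <= a] = [seq x <- u | ~~ (d <= x)].
    apply: eq_in_filter => y yu; move/allP: mu => /(_ y yu).
    by rewrite -ltnNge; move: ad; clear; nlia.
  by apply/permPl; exact: perm_filterC.
have pt' : perm_eq (pre ++ [seq x <- u | d <= x] ++ [seq x <- u | x <= a] ++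
  suf)
             (pre ++ u ++ suf).
  by rewrite perm_cat2l catA perm_cat2r.
split=> //.
- by rewrite (Psymbol_sort us zp ws az aw mu).
- have : uniq (pre ++ [seq x <- u | d <= x] ++ [seq x <- u | x <= a] ++ suf).
    by rewrite (perm_uniq pt').
  rewrite /u /= leqnn ifN -?ltnNge // catA /= => ut.
  by rewrite prec_split // mem_cat mem_filter leqnn mem_cat inE eqxx !orbT.
move=> x y nxy nyx.
have [px py] : pred2 x y x /\ pred2 x y y by rewrite /= !eqxx orbT.
rewrite -(prec_filter (pre ++ _ ++ _ ++ suf) px py).
rewrite -(prec_filter (pre ++ u ++ suf) px py).
congr prec; rewrite !filter_cat; congr cat; rewrite catA; congr cat.
have Pu z' : z' \in u -> pred2 x y z' -> (z' <= a) = (x <= a) || (y <= a) /\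
     (d <= z') = ~~ ((x <= a) || (y <= a)).
  move/(allP mu) => h /= /orP zxy; move: nxy nyx h ad.
  by case: zxy => /eqP->; clear; nlia.
rewrite -!filter_predI.
case h: ((x <= a) || (y <= a)); rewrite h /= in Pu.
  rewrite (@filter_none _ u) => [|c cu /=]; last first.
    by case P: ((c == x) || _) => //=; have [_ ->] := Pu c cu P.
  apply: eq_in_filter => c cu /=; case P: ((c == x) || _) => //=.
  by have [-> _] := Pu c cu P.
rewrite [X in _ ++ X](@filter_none _ u) ?cats0 => [|c cu /=]; last first.
  by case P: ((c == x) || _) => //=; have [-> _] := Pu c cu P.
apply: eq_in_filter => c cu /=; case P: ((c == x) || _) => //=.
by have [_ ->] := Pu c cu P.
Qed.

(** Reversing the words exchanges the two trees and the two forbidden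
    patterns. *)
Lemma misplaced_fix s a d : uniq s -> misplaced s a d ->
  exists t, [/\ perm_eq t s, Psymbol t = Psymbol s, prec t a d != prec s a d &
    forall x y, ~~ ((x <= a) && (d <= y)) -> ~~ ((y <= a) && (d <= x)) ->
      prec t x y = prec s x y].
Proof.
move=> us bs; have [[ad sa sd _] _] := bs.
case: (@prec_total s a d sa) => [e|sad|sda].
- by rewrite e ltnn in ad.
- have [t [pt et tda H]] := misplaced_ascent_fix us bs sad.
  exists t; split=> //; rewrite sad; case: (boolP (prec t a d)) => // h.
  by case: (prec_asym h tda).
have usr : uniq (rev s) by rewrite rev_uniq.
have [|t [pt et tda H]] := misplaced_ascent_fix usr (misplaced_rev us bs)
  (_ : is_true (prec (rev s) a d)).
  by rewrite prec_rev.
have pt' : perm_eq (rev t) s by rewrite perm_rev (perm_trans pt) // perm_rev.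
have ut : uniq t by rewrite (perm_uniq pt).
have mt x : (x \in t) = (x \in s) by rewrite (perm_mem pt) mem_rev.
exists (rev t); split=> //.
- by rewrite -(revK s); apply: Psymbol_rev_eq.
- rewrite prec_rev ?mt // tda; case: (boolP (prec s a d)) => // h.
  by case: (prec_asym h sda).
move=> x y nxy nyx.
have := H y x nyx nxy.
case: (boolP (x \in s)) => xs; case: (boolP (y \in s)) => ys.
- by rewrite !prec_rev ?mt.
- have nt : y \notin rev t by rewrite mem_rev mt.
  by rewrite /prec !(memNindex ys) !(memNindex nt) !index_mem mem_rev mt xs.
- have nt : x \notin rev t by rewrite mem_rev mt.
  by rewrite /prec !(memNindex xs) !(memNindex nt) !ltnNge !index_size.
- have nt : x \notin rev t by rewrite mem_rev mt.
  by rewrite /prec !(memNindex xs) !(memNindex nt) !ltnNge !index_size.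
Qed.

Lemma misplaced_ext s t a d : perm_eq s t ->
  (forall x y, a <= x <= d -> a <= y <= d -> prec t x y = prec s x y) ->
  misplaced s a d -> misplaced t a d.
Proof.
move=> st H [[ad sa sd ns] [x [y [[sx sy ax ay] W]]]].
have aa : a <= a <= d by rewrite leqnn ltnW.
have dd : a <= d <= d by rewrite leqnn ltnW.
have w z : a < z < d -> a <= z <= d
  by case/andP=> h1 h2; rewrite (ltnW h1) (ltnW h2).
split.
  split; rewrite -?(perm_mem st) // => z; rewrite -(perm_mem st) => sz az.
  by have wz := w z az; rewrite !H //; apply: ns.
exists x, y; rewrite -!(perm_mem st); split=> //.
by have [wx wy] := (w x ax, w y ay); rewrite !H.
Qed.

(** Repairing a misplaced pair of minimal difference creates no other
    misplaced pair of at most this difference, so that all of them can be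
    removed. *)
Lemma exists_well_placed (s : perm_word) k :
  exists t, [/\ perm_eq t s, Psymbol t = Psymbol s & well_placed k t].
Proof.
elim: k => [|k [t [pt et nbt]]].
  exists s; split=> // a d; rewrite addn0 => da [[ad _ _ _] _].
  by move: (ltn_trans da ad); rewrite ltnn.
pose N := (size s).+1.
pose nbad (t : seq nat) :=
  #|[pred p : 'I_N * 'I_N | (p.2 == p.1 + k :> nat) &&
    `[<misplaced t p.1 p.2>]]|.
have [n] := ubnP (nbad t); elim: n t pt et nbt => // n IHn t pt et nbt.
rewrite ltnS => le_n.
have ut : uniq t by rewrite (perm_uniq pt) uniq_perm_word.
have [[a [d [da bt]]]|nb] := pselect (exists a d, d = a + k /\ misplaced t a d);
  last first.
  exists t; split=> // a d; rewrite addnS ltnS leq_eqVlt => /orP[/eqP e|];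
    last exact: nbt.
  by move=> b; apply: nb; exists a, d.
have [t' [pt' et' ne H]] := misplaced_fix ut bt.
have ut' : uniq t' by rewrite (perm_uniq pt').
have [[ad ta td ns] [x0 [y0 [[tx0 ty0 ax0 ay0] W]]]] := bt.
have Hs a' d' x y : d' <= a' + k -> (a' != a) || (d' != d) ->
    a' <= x <= d' -> a' <= y <= d' -> prec t' x y = prec t x y.
  by move=> h1 h2 h3 h4; apply: H; move: da ad h1 h2 h3 h4; clear; nlia.
have tt' : perm_eq t' t := pt'.
have Hb a' d' : d' <= a' + k -> (a' != a) || (d' != d) -> misplaced t' a' d' ->
  misplaced t a' d'.
  move=> h1 h2; apply: misplaced_ext => // x y h3 h4.
  by rewrite (Hs a' d').
have Hp x : a < x < d -> (prec t' x a = prec t x a) *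
  (prec t' a x = prec t a x) *
    (prec t' x d = prec t x d) * (prec t' d x = prec t d x).
  by move=> h; split; [split; [split|]|]; apply: H; move: h da; clear; nlia.
(* by [straddle_free], at most one of the two orders of [a] and [d] is
   misplaced *)
have nbad' : ~ misplaced t' a d.
  case=> _ [x1 [y1 [[tx1 ty1 ax1 ay1]]]];
    rewrite !(Hp x1 ax1) !(Hp y1 ay1) => W'.
  rewrite (perm_mem tt') in tx1; rewrite (perm_mem tt') in ty1.
  have nb : well_placed (d - a) t by rewrite da addKn.
  have bb z : z \in t -> a < z < d -> prec t z a -> prec t z d.
    by move=> tz az za; case: (ns z tz az) => -[] // /(prec_asym za).
  have bb' z : z \in t -> a < z < d -> prec t z d -> prec t z a.
    by move=> tz az zd; case: (ns z tz az) => -[] // _ /(prec_asym zd).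
  have aa z : z \in t -> a < z < d -> prec t a z -> prec t d z.
    by move=> tz az za; case: (ns z tz az) => -[] // /(prec_asym za).
  have aa' z : z \in t -> a < z < d -> prec t d z -> prec t a z.
    by move=> tz az zd; case: (ns z tz az) => -[] // _ /(prec_asym zd).
  have t'a : a \in t' by rewrite (perm_mem tt').
  have nad : a <> d by move=> e; rewrite e ltnn in ad.
  case: W => -[p1 p2 p3 p4]; case: W' => -[q1 q2 q3 q4].
  - by rewrite q1 p1 in ne.
  - apply: (@straddle_free t a d x1 y1 x0 y0) => //; split=> //; auto.
  - apply: (@straddle_free t a d x0 y0 x1 y1) => //; split=> //; auto.
  - have h1 : prec t a d = false by apply/negP => /(prec_asym p1).
    have h2 : prec t' a d = false by apply/negP => /(prec_asym q1).
    by rewrite h1 h2 in ne.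
apply: (IHn t').
- exact: perm_trans pt' pt.
- by rewrite et'.
- move=> a' d' da'; have [/andP[/eqP-> /eqP->]|] :=
    boolP ((a' == a) && (d' == d)).
    exact: nbad'.
  by rewrite negb_and => ne' /(Hb _ _ (ltnW da') ne'); apply: nbt.
apply: leq_trans le_n; apply: proper_card; apply/properP; split.
  apply/fintype.subsetP => -[a' d'] /=; rewrite !inE /= => /andP[e /asboolP b].
  rewrite e /=; apply/asboolP.
  have [/andP[/eqP e1 /eqP e2]|] := boolP
    ((a' == a :> nat) && (d' == d :> nat)).
    by rewrite e1 e2 in b.
  by rewrite negb_and => ne'; apply: Hb => //; rewrite (eqP e).
have [la ld] : a < N /\ d < N.
  move: ta td; rewrite !(perm_mem pt) !mem_perm_word /N; clear; nlia.
exists (Ordinal la, Ordinal ld).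
  by rewrite inE /= da eqxx -da; apply/asboolP.
by rewrite inE /=; apply/nandP; right; apply/asboolPn.
Qed.

Lemma well_placed_baxter (s : perm_word) :
  (forall a d, ~ misplaced s a d) -> is_baxter s.
Proof.
move=> nb p u v w a b c d es.
have us := uniq_perm_word s.
have e1 : word s = (p ++ a :: u) ++ [:: b, c & v ++ d :: w].
  by rewrite es -!catA.
have := us; rewrite e1 => /split_adjacent[_ ec bef aft].
have bc : prec s b c by rewrite e1; apply: prec_adjacent; rewrite -e1.
have ab : prec s a b by rewrite e1; apply: bef; rewrite mem_cat mem_head orbT.
have cd : prec s c d by rewrite e1; apply: aft; rewrite mem_cat mem_head orbT.
have sa := prec_mem ab; have sb := prec_mem bc; have sc := prec_mem cd.
have sd : d \in (word s) by rewrite es !mem_cat !inE !mem_cat !inE eqxx !orbT.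
have ns x : x \in word s -> x != b -> x != c ->
    (prec s x b /\ prec s x c) \/ (prec s b x /\ prec s c x).
  rewrite e1 => xs nb' nc; case/orP: (mem_adjacent xs nb' nc) => h; rewrite -e1.
    have h' : prec s x b by rewrite e1; apply: bef.
    by left; split=> //; apply: prec_trans bc.
  have h' : prec s c x by rewrite e1; apply: aft.
  by right; split=> //; apply: prec_trans h'.
split; apply/negP => /and3P[h1 h2 h3].
  apply: (nb c b); split.
    split=> // [|x xs /andP[cx xb]]; first
      by rewrite (ltn_trans h1) // (ltn_trans h2).
    by case: (ns x xs) => [||[]|[]]; [| | left | right] => //;
       apply/eqP => e; [rewrite e ltnn in xb|rewrite e ltnn in cx].
  exists a, d; split; last by right; split=> //; apply: prec_trans bc.
  by split=> //; rewrite ?h1 ?h3 ?(ltn_trans h1 h2) ?(ltn_trans h2 h3).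
apply: (nb b c); split.
  split=> // [|x xs /andP[bx xc]]; first
    by rewrite (ltn_trans h1) // (ltn_trans h2).
  by apply: ns => //; apply/eqP => e;
    [rewrite e ltnn in bx|rewrite e ltnn in xc].
exists a, d; split; last by left; split=> //; apply: prec_trans bc.
by split=> //; rewrite ?h1 ?h3 ?(ltn_trans h1 h2) ?(ltn_trans h2 h3).
Qed.

Lemma exists_baxter (s : perm_word) :
  exists t : perm_word, is_baxter t /\ Psymbol t = Psymbol s.
Proof.
have [w [pw ew nb]] := exists_well_placed s (size s).+1.
have [t et] := perm_word_of pw.
exists t; rewrite et; split=> //; apply: well_placed_baxter => a d b.
apply: (nb a d); last by rewrite -et.
case: b => -[_ _ + _] _; rewrite mem_perm_word.
have -> : size t = size s by rewrite et (perm_size pw).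
clear; nlia.
Qed.

(** * Connectedness *)

(** A Baxter permutation avoids the pattern 2-41-3 even when the letters 4 and
    1 are only unseparated: the adjacent letters where the values drop from
    [>= d] to [<= a] give an instance of the pattern. *)
Lemma baxter_straddle (s : perm_word) a d x y : is_baxter s ->
  a \in word s -> d \in word s -> prec s d a ->
  (forall z, z \in word s -> a < z < d -> prec s d z -> prec s z a -> False) ->
  x \in word s -> prec s x d -> y \in word s -> prec s a y ->
  a < x -> x < y -> y < d -> False.
Proof.
move=> bs sa sd da nz sx xd sy ay ax xy yd; have us := uniq_perm_word s.
have ad : a < d := ltn_trans (ltn_trans ax xy) yd.
have [||q [r [qs rs dq ndr [e iq ir]]]] :=
  @crossing (fun z => d <= z) s d a us sd sa da.
- exact: leqnn.
- by rewrite -ltnNge.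
rewrite -ltnNge in ndr.
have qr : prec s q r by rewrite /prec e.
have ra : r <= a.
  rewrite leqNgt; apply/negP => ar; apply: (nz r rs); rewrite ?ar //.
    by rewrite /prec e ltnS.
  rewrite /prec ltn_neqAle ir andbT; apply/eqP => /(index_inj_mem rs) h.
  by rewrite h ltnn in ar.
have [u [v [es inu inw]]] := adjacent_split us qs rs e.
have xu : x \in u by apply: inu => //; apply: leq_trans xd iq.
have yv : y \in v by apply: inw => //; apply: leq_ltn_trans ir ay.
case/splitPr: xu es => u1 u2; case/splitPr: yv => v1 v2 es.
have := bs u1 u2 v1 v2 x q r y; rewrite es -catA => /(_ erefl)[+ _].
by rewrite (leq_ltn_trans ra ax) xy (leq_trans yd dq).
Qed.

Definition splits_at k s : Prop :=
  forall a d, a \in s -> d \in s -> a <= k -> k < d -> prec s a d.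

Lemma splits_at_le k (s t : perm_word) :
  perm_le s t -> splits_at k t -> splits_at k s.
Proof.
move=> /perm_leP[sz le] ct a d sa sd ak kd.
have mst := perm_mem (perm_eq_word sz).
have ad : a < d := leq_ltn_trans ak kd.
case: (@prec_total s a d sa) => [e||/(le _ _ ad) h] //; first
  by rewrite e ltnn in ad.
by case: (prec_asym (ct a d _ _ ak kd) h); rewrite -mst.
Qed.

(** If [t] violates the conclusion, consider an inversion [d..a] across [k]
    with minimal difference.  It is unseparated, the values between [a] and
    [d] located before it are [<= k] and those located after it are [> k], and
    both kinds exist because the class does not force [d] before [a].  This is
    the forbidden pattern 2-41-3. *)
Lemma splits_at_baxter k (s t : perm_word) :
  Psymbol s = Psymbol t -> is_baxter t -> splits_at k s -> splits_at k t.
Proof.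
move=> est bt cs; have sz := size_Psymbol est.
have mst := perm_mem (perm_eq_word sz); have ut := uniq_perm_word t.
suff H a d : a \in word t -> d \in word t -> a <= k -> k < d -> prec t d a ->
  False.
  move=> a d ta td ak kd; case: (@prec_total t a d ta) => // [e|h].
    by move: ak; rewrite e leqNgt kd.
  by case: (H a d).
have [n] := ubnP (d - a); elim: n a d => // n IHn a d.
rewrite ltnS => le_n ta td ak kd tda.
have ad : a < d := leq_ltn_trans ak kd.
have nf : ~ forced t a d.
  move=> /(forced_class ut (perm_eq_word (esym sz)) ta td ad (esym est)).
  rewrite -mst in ta; rewrite -mst in td.
  by move=> /(forced_prec ta td ad)/(prec_asym (cs a d ta td ak kd)).
have nsep z : z \in word t -> a < z < d -> prec t d z -> prec t z a -> False.
  move=> tz /andP[az zd] dz za; case: (leqP z k) => zk.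
    by apply: (IHn z d) => //; move: az zd le_n; clear; nlia.
  by apply: (IHn a z) => //; move: az zd le_n; clear; nlia.
have [x [tx ax xd tdx]] : exists x,
  [/\ x \in word t, a < x, x < d & prec t x d].
  apply: contrapT => no; apply: nf; left => x tx /andP[ax xd].
  have [<-//|nax] := eqVneq a x.
  case: (@prec_total t x d tx) => // [e|h]; first by rewrite e ltnn in xd.
  by case: no; exists x; rewrite ltn_neqAle nax ax.
have [y [ty ay yd tay]] : exists y,
  [/\ y \in word t, a < y, y < d & prec t a y].
  apply: contrapT => no; apply: nf; right => y ty /andP[ay yd].
  have [->//|nyd] := eqVneq y d.
  case: (@prec_total t y a ty) => // [e|h]; first by rewrite e ltnn in ay.
  by case: no; exists y; split=> //; rewrite ltn_neqAle nyd.
have xk : x <= k.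
  rewrite leqNgt; apply/negP => kx; apply: (IHn a x) => //.
    by move: ax xd le_n; clear; nlia.
  exact: prec_trans tda.
have ky : k < y.
  rewrite ltnNge; apply/negP => yk; apply: (IHn y d) => //.
    by move: ay yd le_n; clear; nlia.
  exact: prec_trans tay.
apply: (@baxter_straddle t a d x y) => //.
exact: leq_ltn_trans xk ky.
Qed.

Lemma is_over_splits_at (s nu pi : perm_word) :
  is_over s nu pi -> splits_at (size nu) s.
Proof.
move=> es a d sa sd ak kd; have us := uniq_perm_word s.
have an : a \in word nu.
  by rewrite mem_perm_word ak; move: sa; rewrite mem_perm_word => /andP[->].
have dn : d \notin word nu by rewrite mem_perm_word; move: kd; clear; nlia.
rewrite es /prec !index_cat an (negbTE dn).
by apply: leq_trans (leq_addr _ _); rewrite index_mem.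
Qed.

Lemma splits_at_filter k s : uniq s -> splits_at k s ->
  s = [seq x <- s | x <= k] ++ [seq x <- s | k < x].
Proof.
elim: s => //= x s IHs /andP[xs us] cs.
have nx y : y \in s -> (x == y) = false
  by move=> ys; apply/eqP => e; rewrite e ys in xs.
case: (leqP x k) => xk /=.
  congr cons; apply: IHs => // a d sa sd ak kd.
  have := cs a d; rewrite !inE sa sd !orbT /prec /= !nx // ltnS; by apply.
rewrite (@filter_none _ s) /= => [|y ys]; last first.
  rewrite -ltnNge ltnNge; apply/negP => yk.
  have := cs y x; rewrite !inE ys eqxx orbT /prec /= eqxx ltn0 /=;
    by move=> /(_ isT isT yk xk).
rewrite (@Defs.filter_all (fun y => k < y) s) // => y ys; rewrite ltnNge;
  apply/negP => yk.
have := cs y x; rewrite !inE ys eqxx orbT /prec /= eqxx ltn0 /=;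
  by move=> /(_ isT isT yk xk).
Qed.

Lemma splits_at_is_over k (s : perm_word) : k <= size s -> splits_at k s ->
  exists nu pi, is_over s nu pi /\ size nu = k.
Proof.
move=> ks cs; have us := uniq_perm_word s.
have pn : perm_eq [seq x <- s | x <= k] (iota 1 k).
  apply: uniq_perm; rewrite ?filter_uniq ?iota_uniq // => x.
  by rewrite mem_filter mem_perm_word mem_iota; move: ks; clear; nlia.
have pp : perm_eq [seq x - k | x <- s & k < x] (iota 1 (size s - k)).
  have -> : iota 1 (size s - k) = [seq x - k | x <- iota k.+1 (size s - k)].
    rewrite -[k.+1]addn1 iotaDl -map_comp -[LHS]map_id; apply: eq_map => x /=.
    by rewrite addKn.
  apply: perm_map; apply: uniq_perm; rewrite ?filter_uniq ?iota_uniq // => x.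
  by rewrite mem_filter mem_perm_word mem_iota; move: ks; clear; nlia.
have sn : size [seq x <- s | x <= k] = k by rewrite (perm_size pn) size_iota.
have hn : perm_eq [seq x <- s | x <= k] (iota 1 (size [seq x <- s | x <= k])).
  by rewrite sn.
have hp : perm_eq [seq x - k | x <- s & k < x]
  (iota 1 (size [seq x - k | x <- s & k < x])).
  by rewrite (perm_size pp) size_iota.
exists (PermWord hn), (PermWord hp); split; last exact: sn.
rewrite /is_over /= sn [LHS](splits_at_filter us cs); congr cat.
rewrite /shift -map_comp -[LHS]map_id; apply/eq_in_map => x.
by rewrite mem_filter => /andP[kx _] /=; rewrite subnKC // ltnW.
Qed.

Lemma size_is_over (s nu pi : perm_word) : is_over s nu pi ->
  size s = size nu + size pi.
Proof. by move=> ->; rewrite size_cat size_map. Qed.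

Lemma is_over0 (s nu pi : perm_word) : is_over s nu pi -> size nu = 0 -> pi = s.
Proof.
move=> es /size0nil en; apply: val_inj; rewrite /= es en /=.
by rewrite /shift -[LHS]map_id.
Qed.

Lemma is_over_full (s nu pi : perm_word) :
  is_over s nu pi -> size pi = 0 -> nu = s.
Proof.
by move=> es /size0nil en; apply: val_inj; rewrite /= es en cats0.
Qed.

Lemma connectedP (s : perm_word) :
  perm_connected s <-> (forall k, 0 < k -> k < size s -> ~ splits_at k s).
Proof.
split=> [cs k k0 ks /(splits_at_is_over (ltnW ks))[nu [pi [es sn]]]|H nu pi es].
  case: (cs nu pi es) => e; first by move: ks; rewrite -sn e ltnn.
  by have := size_is_over es; rewrite e sn; move: k0; clear; nlia.
have sz := size_is_over es.
have [/is_over0 h|n0] := posnP (size nu); first by right; apply: h.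
have [/is_over_full h|p0] := posnP (size pi); first by left; apply: h.
case: (H _ n0 _ (is_over_splits_at es)); rewrite sz; move: p0; clear; nlia.
Qed.

(** The reduced permutation lies below the Baxter permutation of its class,
    and the property of starting with the [k] smallest letters goes down along
    the order; [splits_at_baxter] is the converse. *)
Lemma connected_class (s t : perm_word) :
  reduced s -> is_baxter t -> Psymbol s = Psymbol t ->
  perm_connected s <-> perm_connected t.
Proof.
move=> irs bt e; have sz := size_Psymbol e; rewrite !connectedP sz.
split=> H k k0 ks c; apply: (H k k0 ks); last exact: splits_at_baxter c.
apply: splits_at_le c; exact: (reduced_le_class irs erefl (rt_refl _ _ s) e).
Qed.

End BaxterPermutations.

(** * The operation over *)

Section Over.
Implicit Types (s t r p : perm_word) (u v w : seq nat)
  (a b c d q x y z n : nat).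

Lemma over_subproof s t :
  perm_eq (s ++ shift (size s) t) (iota 1 (size (s ++ shift (size s) t))).
Proof. by rewrite size_cat size_map perm_word_over. Qed.

Definition over_perm s t : perm_word := PermWord (over_subproof s t).

Lemma size_over s t : size (over_perm s t) = size s + size t.
Proof. by rewrite size_cat size_map. Qed.

Lemma over0s s : over_perm empty_perm s = s.
Proof. by apply: val_inj; rewrite /= /shift map_id. Qed.

Lemma overs0 s : over_perm s empty_perm = s.
Proof. by apply: val_inj; rewrite /= cats0. Qed.

Lemma overA s t r : over_perm s (over_perm t r) = over_perm (over_perm s t) r.
Proof.
apply: val_inj; rewrite /= /shift map_cat -catA -map_comp size_cat size_map.
by congr (_ ++ (_ ++ _)); apply: eq_map => x /=; rewrite addnA.
Qed.

Lemma filter_le_over s t : [seq x <- over_perm s t | x <= size s] = s.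
Proof.
rewrite /= filter_cat (@Defs.filter_all _ (word s)) => [|x]; last first.
  by rewrite mem_perm_word => /andP[].
rewrite filter_none ?cats0 // => x /mapP[y + ->].
rewrite mem_perm_word; clear; nlia.
Qed.

Lemma filter_gt_over s t :
  [seq x <- over_perm s t | size s < x] = shift (size s) t.
Proof.
rewrite /= filter_cat (@filter_none _ (word s)) => [|x]; last first.
  by rewrite mem_perm_word -leqNgt => /andP[].
rewrite Defs.filter_all // => x /mapP[y + ->].
rewrite mem_perm_word; clear; nlia.
Qed.

Lemma shift_inj n : injective (shift n).
Proof. by apply: inj_map; apply: addnI. Qed.

Lemma exists_restriction n p : n <= size p ->
  exists s t, [/\ word s = [seq x <- p | x <= n],
    shift n t = [seq x <- p | n < x], size s = n & size p = n + size t].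
Proof.
move=> np; have up := uniq_perm_word p.
pose w := [seq x <- p | x <= n] ++ [seq x <- p | n < x].
have pw : perm_eq w p.
  rewrite /w; under [X in _ ++ X]eq_filter do rewrite ltnNge.
  by apply/permPl; apply: perm_filterC.
have [p' ep'] := perm_word_of pw.
have sp' : size p' = size p by rewrite ep' (perm_size pw).
have [||s [t [est sn]]] := @splits_at_is_over n p'.
- by rewrite sp'.
- move=> a d; rewrite !mem_perm_word sp' => sa sd an nd.
  have la : a \in [seq x <- p | x <= n] by rewrite mem_filter an mem_perm_word.
  have nl : d \notin [seq x <- p | x <= n] by rewrite mem_filter leqNgt nd.
  rewrite /prec ep' /w !index_cat la (negbTE nl).
  by apply: leq_trans (leq_addr _ _); rewrite index_mem.
- exists s, t; have := size_is_over est; rewrite sn sp' => sz.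
  have /eqP : word p' = s ++ shift n t by rewrite est sn.
  rewrite ep' /w eqseq_cat.
    by case/andP=> /eqP-> /eqP->.
  rewrite sn.
  have : perm_eq [seq x <- p | x <= n] (iota 1 n).
    apply: uniq_perm; rewrite ?filter_uniq ?iota_uniq // => x.
    by rewrite mem_filter mem_perm_word mem_iota; move: np; clear; nlia.
  by move/perm_size; rewrite size_iota.
Qed.

Lemma prec_shift n w x y : prec (shift n w) (n + x) (n + y) = prec w x y.
Proof. by rewrite /prec !index_map //; apply: addnI. Qed.

(** There is no descent at the junction, and the values between the two
    letters of any other descent belong to the same factor as these letters.
    *)
Lemma reduced_over s t : reduced (over_perm s t) <-> reduced s /\ reduced t.
Proof.
split=> [ir|[irs irt]].
  split=> u v d a x y es xu yv ax ay.
    apply: (ir u (v ++ shift (size s) t) d a x y) => //.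
      by rewrite /= {1}es -catA.
    by rewrite mem_cat yv.
  apply: (ir (s ++ shift (size s) u) (shift (size s) v) (size s + d)
            (size s + a) (size s + x) (size s + y)).
  - by rewrite /= es /shift map_cat -catA.
  - by rewrite mem_cat map_f ?orbT.
  - by rewrite map_f.
  - by rewrite !ltn_add2l.
  - by rewrite !ltn_add2l.
move=> u v d a x y es xu yv /andP[ax xd] /andP[ay yd].
have mem z : z \in u ++ [:: d, a & v] -> 0 < z
  by rewrite -es mem_perm_word => /andP[].
case: (leqP d (size s)) => ds.
  have le z : z < d -> z <= size s
    by move=> zd; apply: leq_trans ds; apply: ltnW.
  apply: (irs [seq z <- u | z <= size s] [seq z <- v | z <= size s] d a x y).
  - by rewrite -[LHS](filter_le_over s t) es filter_cat /= ds (le a) //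
      (ltn_trans ax).
  - by rewrite mem_filter le.
  - by rewrite mem_filter le.
  - by rewrite ax.
  - by rewrite ay.
have dw : prec (over_perm s t) d a.
  rewrite es; apply: prec_adjacent; rewrite -es; exact: uniq_perm_word.
have as_ : size s < a.
  rewrite ltnNge; apply/negP => as_.
  have : prec (over_perm s t) a d.
    by apply: (@is_over_splits_at _ s t) => //;
      rewrite es mem_cat !inE eqxx !orbT.
  exact: prec_asym dw.
have lt z : a < z -> size s < z by apply: ltn_trans.
have sub z : size s < z -> size s + (z - size s) = z
  by move=> h; rewrite subnKC // ltnW.
pose g := map (fun z => z - size s).
have gK w : g (shift (size s) w) = w.
  by rewrite /g /shift -map_comp -[RHS]map_id; apply: eq_map => z /=;
    rewrite addKn.
have gf w z : z \in w -> size s < z -> z - size s \in g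
  [seq z <- w | size s < z].
  by move=> zw sz; apply: map_f; rewrite mem_filter sz.
apply: (irt (g [seq z <- u | size s < z]) (g [seq z <- v | size s < z])
  (d - size s) (a - size s) (x - size s) (y - size s)).
- by rewrite -[LHS]gK -filter_gt_over es filter_cat /= ds as_ /g map_cat.
- by apply: gf => //; apply: lt.
- by apply: gf => //; apply: lt.
- by move: ax xd as_; clear; nlia.
- by move: ay yd as_; clear; nlia.
Qed.

Lemma over_inj s1 s2 t1 t2 : size s1 = size s2 ->
  over_perm s1 t1 = over_perm s2 t2 -> s1 = s2 /\ t1 = t2.
Proof.
move=> sz e; split; apply: val_inj => /=.
  by rewrite -(filter_le_over s1 t1) e sz filter_le_over.
apply: (@shift_inj (size s1)).
by rewrite -filter_gt_over e {2}sz -filter_gt_over sz.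
Qed.

(** * Unique factorization into connected permutations *)

Definition atom s : Prop := 0 < size s /\ perm_connected s.

Definition overs (l : seq perm_word) : perm_word :=
  foldr over_perm empty_perm l.

Lemma exists_atoms s : exists l, (forall t, t \in l -> atom t) /\ overs l = s.
Proof.
have [n] := ubnP (size s); elim: n s => // n IHn s; rewrite ltnS => le_n.
have [s0|s_gt0] := posnP (size s).
  by exists [::]; split=> //; apply: val_inj; rewrite /= (size0nil s0).
have [cs|ncs] := pselect (perm_connected s).
  by exists [:: s]; split=> [t|]; [rewrite inE => /eqP-> | rewrite /= overs0].
have [k [k0 ks ck]] : exists k, [/\ 0 < k, k < size s & splits_at k s].
  apply: contrapT => H; apply: ncs; apply/connectedP => k k0 ks ck.
  by apply: H; exists k.
have [nu [pi [es sk]]] := splits_at_is_over (ltnW ks) ck.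
have sz := size_is_over es.
have [|l1 [a1 e1]] := IHn nu; first by move: sz sk ks le_n; clear; nlia.
have [|l2 [a2 e2]] := IHn pi; first by move: sz sk k0 le_n; clear; nlia.
exists (l1 ++ l2); split=> [t|]; first by rewrite mem_cat => /orP[/a1|/a2].
have -> : overs (l1 ++ l2) = over_perm (overs l1) (overs l2).
  by elim: l1 {a1 e1} => [|t l1 IH] /=; rewrite ?over0s // IH overA.
by apply: val_inj; rewrite e1 e2.
Qed.

(** A shorter first factor [s1] would split the connected permutation [s2]. *)
Lemma atom_prefix s1 s2 t1 t2 : atom s1 -> atom s2 ->
  over_perm s1 t1 = over_perm s2 t2 -> size s1 <= size s2 -> size s1 = size s2.
Proof.
move=> [s10 _] [_ /connectedP cs2] e; rewrite leq_eqVlt => /orP[/eqP//|lt].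
case: (cs2 _ s10 lt) => a d sa sd a1 d1.
have : prec (over_perm s2 t2) a d.
  rewrite -e; apply: (@is_over_splits_at _ s1 t1) => //;
   by rewrite e /= mem_cat ?sa ?sd.
have le z : z \in word s2 -> z <= size s2 by rewrite mem_perm_word => /andP[].
by rewrite -(@prec_filter (fun z => z <= size s2)) ?le ?filter_le_over.
Qed.

Lemma overs_inj l1 l2 :
  (forall t, t \in l1 -> atom t) -> (forall t, t \in l2 -> atom t) ->
  overs l1 = overs l2 -> l1 = l2.
Proof.
have pos s t : atom s -> over_perm s t <> empty_perm.
  by move=> [s0 _] /(congr1 (fun r => size (word r))); rewrite size_over /=;
    move: s0; clear; nlia.
elim: l1 l2 => [|s1 l1 IHl] [|s2 l2] //= a1 a2 e.
- by case: (pos s2 (overs l2)) => //; apply: a2; rewrite mem_head.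
- by case: (pos s1 (overs l1)) => //; apply: a1; rewrite mem_head.
have at1 := a1 s1 (mem_head _ _); have at2 := a2 s2 (mem_head _ _).
have sz : size s1 = size s2.
  case/orP: (leq_total (size s1) (size s2)) => h.
    exact: atom_prefix at1 at2 e h.
  exact/esym/(atom_prefix at2 at1 (esym e) h).
have [-> /IHl ->] := over_inj sz e => // t tl.
  by apply: a1; rewrite inE tl orbT.
by apply: a2; rewrite inE tl orbT.
Qed.

Lemma reduced_overs l : reduced (overs l) <-> (forall t, t \in l -> reduced t).
Proof.
elim: l => [|s l IHl] /=.
  by split=> // _ u v d a x y /= e; have := congr1 size e;
    rewrite size_cat /= addnS.
rewrite reduced_over IHl; split=> [[irs irl] t|H]; last first.
  by split=> [|t tl]; apply: H; rewrite inE ?eqxx ?tl ?orbT.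
by rewrite inE => /orP[/eqP->//|]; apply: irl.
Qed.

(** * Shuffles *)

Lemma count_shuffle (P : pred nat) u v w : all P u -> all (predC P) v ->
  count_mem w (shuffle u v) =
  (filter P w == u) && (filter (predC P) w == v).
Proof.
elim: u v w => [|x u IHu] v w.
  rewrite shuffle0s /= addn0 => _ av; congr nat_of_bool.
  apply/eqP/andP => [<-|[/eqP f0 /eqP <-]]; last first.
    by apply/all_filterP; rewrite all_predC has_filter f0.
  split; last by rewrite (all_filterP av).
  by apply/eqP; apply: filter_none => y; apply: (allP av).
move=> /andP[Px au]; elim: v w => [|y v IHv] w.
  rewrite shuffles0 /= addn0 => _; congr nat_of_bool.
  have axu : all P (x :: u) by rewrite /= Px.
  apply/eqP/andP => [<-|[/eqP <- /eqP f0]].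
    split; first by rewrite (all_filterP axu).
    by apply/eqP; apply: filter_none => z /(allP axu) /= ->.
  apply/all_filterP; apply/allP => z zw; apply/negPn/negP => nPz.
  have : z \in filter (predC P) w by rewrite mem_filter /= nPz.
  by rewrite f0.
move=> /andP[nPy av]; rewrite /= in nPy.
have -> : shuffle (x :: u) (y :: v) =
    map (cons x) (shuffle u (y :: v)) ++
    map (cons y) (shuffle (x :: u) v) by [].
rewrite count_cat !count_map.
case: w => [|z w].
  by rewrite /= !(eq_count (a2 := pred0)) ?count_pred0.
have e1 (r : nat) : preim (cons r) (pred1 (z :: w)) =1
    (if r == z then pred1 w else pred0).
  by move=> l /=; rewrite eqseq_cons; case: eqP.
rewrite !(eq_count (e1 _)).
rewrite [filter P (z :: w)]/= [filter (predC P) (z :: w)]/=.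
case Pz: (P z); rewrite ?[~~ true]/= ?[~~ false]/=.
  have -> : (y == z) = false by apply/eqP => e; rewrite e Pz in nPy.
  rewrite count_pred0 addn0 eqseq_cons (eq_sym z).
  case: eqP => [_|_]; last by rewrite count_pred0.
  by rewrite IHu //= nPy.
have -> : (x == z) = false by apply/eqP => e; rewrite e Pz in Px.
rewrite count_pred0 add0n eqseq_cons (eq_sym z).
case: eqP => [_|_]; last by rewrite count_pred0 andbF.
by rewrite IHv.
Qed.

Lemma count_sshuffle s t p :
  count_mem p (sshuffle s t) =
  ([seq x <- p | x <= size s] == s) &&
  ([seq x <- p | size s < x] == shift (size s) t) :> nat.
Proof.
have -> : count_mem p (sshuffle s t) =
    count_mem (word p) (shuffle s (shift (size s) t)).
  by rewrite -val_sshuffle count_map; apply: eq_count => q /=; rewrite -val_eqE.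
rewrite (@count_shuffle (fun x => x <= size s)).
- congr (nat_of_bool (_ && (_ == _))); apply: eq_filter => x /=.
  by rewrite ltnNge.
- by apply/allP => x; rewrite mem_perm_word => /andP[].
apply/allP => x /mapP[y + ->]; rewrite mem_perm_word /=; clear; nlia.
Qed.

(** The inversions of [s / t] are those of [s] and those of [t], both of which
    are seen on the restrictions of [p] to the corresponding values. *)
Lemma perm_le_over s t p s' t' :
  word s' = [seq x <- p | x <= size s] ->
  shift (size s) t' = [seq x <- p | size s < x] ->
  size s' = size s -> size p = size s + size t' ->
  perm_le (over_perm s t) p <-> perm_le s s' /\ perm_le t t'.
Proof.
move=> es' et' ss' sp.
have hs x y : x <= size s -> y <= size s -> prec p x y = prec s' x y.
  by move=> xs ys; rewrite es' prec_filter.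
have ht x y : 0 < x -> 0 < y -> prec p (size s + x) (size s + y) = prec t' x y.
  move=> x0 y0; rewrite -(prec_shift (size s) t') et' prec_filter //.
    by move: x0; clear; nlia.
  by move: y0; clear; nlia.
have hs' x y : x <= size s -> y <= size s -> prec (over_perm s t) x y = prec s x
  y.
  by move=> xs ys; rewrite -(@prec_filter (fun z => z <= size s))
    ?filter_le_over.
have ht' x y : 0 < x -> 0 < y ->
    prec (over_perm s t) (size s + x) (size s + y) = prec t x y.
  move=> x0 y0; rewrite -(prec_shift (size s) t) -filter_gt_over prec_filter //.
    by move: x0; clear; nlia.
  by move: y0; clear; nlia.
rewrite !perm_leP; split=> [[sz le]|[[_ les] [szt let_]]].
  have szt : size t = size t'.
    by move: sz; rewrite size_over sp => /addnI.
  split; split=> //.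
    apply: inv_leI => [|a d sa sd ad]; first exact: perm_eq_word.
    move: sa sd; rewrite !mem_perm_word => /andP[_ sa] /andP[_ sd].
    by rewrite -hs' // -hs //; apply: le.
  apply: inv_leI => [|a d ta td ad]; first exact: perm_eq_word.
  move: ta td; rewrite !mem_perm_word => /andP[ta _] /andP[td _].
  by rewrite -ht' // -ht //; apply: le; rewrite ltn_add2l.
have sz : size (over_perm s t) = size p by rewrite size_over sp szt.
split=> //; apply: inv_leI => [|a d]; first exact: perm_eq_word.
rewrite !mem_perm_word => /andP[a0 sa] /andP[d0 sd] ad.
case: (leqP d (size s)) => ds.
  have as_ : a <= size s by apply: leq_trans ds; apply: ltnW.
  by rewrite hs' // hs //; apply: les.
case: (leqP a (size s)) => as_.
  move=> h; have : prec (over_perm s t) a d.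
    by apply: is_over_splits_at => //; rewrite mem_perm_word ?a0 ?d0.
  by move/(prec_asym h).
have ea : a = size s + (a - size s) by rewrite subnKC // ltnW.
have ed : d = size s + (d - size s) by rewrite subnKC // ltnW.
rewrite ea ed ht' ?subn_gt0 // ht ?subn_gt0 //; apply: let_.
by move: ad as_; clear; nlia.
Qed.

End Over.

(** * Upper sums in FQSym *)

Import GRing.Theory.
Local Open Scope ring_scope.
Local Open Scope classical_set_scope.

Definition symbol (s : perm_word) : TBT := TwinTrees (twin_Psymbol s).

Section Algebra.
Variable K : fieldType.
Implicit Types (s t p : perm_word) (J : TBT).

Lemma mcoeff_basisF s t : (basisF K s)@_t = (s == t)%:R.
Proof. by rewrite mcoeffU. Qed.

Lemma mcoeff_fsum (T : choiceType) (A : set T) (F : T -> FQSym K) t :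
  finite_set A -> (\sum_(i \in A) F i)@_t = \sum_(i \in A) (F i)@_t.
Proof. by move=> fA; rewrite !fsbig_finite // (raddf_sum (mcoeff t)). Qed.

Lemma fsum_indic (T : choiceType) (A : set T) (t : T) :
  \sum_(i \in A) ((i == t)%:R : K) = (t \in A)%:R.
Proof.
rewrite fsbig_mkcond -(fsbig_widen [set t] setT) ?fsbig_set1 //=.
  by rewrite /patch eqxx; case: (t \in A).
by move=> i [_ /= /eqP/negbTE it]; rewrite /= /patch it; case: (i \in A).
Qed.

Definition upper_sum s : FQSym K :=
  \sum_(t \in [set t | perm_le s t]) basisF K t.

Lemma finite_upper s : finite_set [set t | perm_le s t].
Proof.
by apply: sub_finite_set (finite_perm_word (size s)) => t /= /perm_le_size.
Qed.

Lemma mcoeff_upper_sum s t : (upper_sum s)@_t = `[< perm_le s t >]%:R.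
Proof.
rewrite mcoeff_fsum; last exact: finite_upper.
by under eq_fsbigr do rewrite mcoeff_basisF; rewrite fsum_indic.
Qed.

Lemma mcoeff_basisP J t : (basisP K J)@_t = (J == symbol t)%:R.
Proof.
rewrite mcoeff_fsum; last exact: finite_symbol.
under eq_fsbigr do rewrite mcoeff_basisF; rewrite fsum_indic.
congr ((nat_of_bool _)%:R); apply/idP/eqP => [|->]; rewrite inE //=.
by move=> e; apply: val_inj.
Qed.

Lemma mcoeff_basisE J t : (basisE K J)@_t = `[< baxter_le J (symbol t) >]%:R.
Proof.
rewrite mcoeff_fsum; last exact: finite_baxter_le.
by under eq_fsbigr do rewrite mcoeff_basisP; rewrite fsum_indic.
Qed.

Lemma baxter_le_reduced s t : reduced s ->
  baxter_le (symbol s) (symbol t) <-> perm_le s t.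
Proof.
move=> irs; split=> [[s' [t' [es et le]]]|le]; last by exists s, t.
exact: reduced_le_class irs es le et.
Qed.

Lemma basisE_upper_sum s : reduced s -> basisE K (symbol s) = upper_sum s.
Proof.
move=> irs; apply/malgP => t; rewrite mcoeff_basisE mcoeff_upper_sum.
by congr ((nat_of_bool _)%:R); apply: asbool_equiv_eq; apply: baxter_le_reduced.
Qed.

Lemma upper_sum_empty : upper_sum empty_perm = 1.
Proof.
apply/malgP => t; rewrite mcoeff_upper_sum.
have -> : (1 : FQSym K) = basisF K empty_perm by [].
rewrite mcoeff_basisF; congr ((nat_of_bool _)%:R).
apply/asboolP/eqP => [/perm_le_size /esym/size0nil e|<-]; last exact: rt_refl.
exact: val_inj.
Qed.

(** Each [p] above [s / t] arises exactly once, namely as a shuffle of its two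
    restrictions to the values [<= |s|] and [> |s|]. *)
Lemma upper_sum_mul s t : upper_sum s * upper_sum t = upper_sum (over_perm s t).
Proof.
apply/malgP => p; rewrite [in RHS]mcoeff_upper_sum.
pose A := fset_set [set s' | perm_le s s'].
pose B := fset_set [set t' | perm_le t t'].
have inA s' : s' \in A = `[< perm_le s s' >]
  by rewrite in_fset_set //; exact: finite_upper.
have inB t' : t' \in B = `[< perm_le t t' >]
  by rewrite in_fset_set //; exact: finite_upper.
rewrite /upper_sum !fsbig_finite; try exact: finite_upper.
rewrite -/A -/B mulr_suml (raddf_sum (mcoeff p)).
have -> : \sum_(s' <- A) (basisF K s' * \sum_(t' <- B) basisF K t')@_p =
    \sum_(s' <- A) \sum_(t' <- B)
      (([seq x <- p | (x <= size s)%N] == s') &&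
       ([seq x <- p | (size s < x)%N] == shift (size s) t'))%:R :> K.
  apply: eq_big_seq => s'; rewrite inA => /asboolP /perm_le_size sz.
  rewrite mulr_sumr (raddf_sum (mcoeff p)); apply: eq_bigr => t' _ /=.
  have -> : basisF K s' * basisF K t' = basisF_mul K s' t' by apply: FQSym_mulF.
  rewrite /basisF_mul (raddf_sum (mcoeff p)) /=.
  under eq_bigr do rewrite mcoeff_basisF.
  rewrite sz -count_sshuffle -natr_sum; congr (_%:R).
  by rewrite -sum1_count [RHS]big_mkcond; apply: eq_bigr => q _ /=; case: eqP.
case: (leqP (size s) (size p)) => np; last first.
  rewrite big1_seq => [|s' /andP[_]].
    case: asboolP => // /perm_le_size; rewrite size_over; move: np; clear; nlia.
  rewrite inA => /asboolP/perm_le_size sz; rewrite big1 // => t' _.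
  rewrite [X in X && _](_ : _ = false) //; apply/eqP => /(congr1 size).
  rewrite -sz size_filter => e; move: np; rewrite -e ltnNge.
  by rewrite count_size.
have [s0 [t0 [es0 et0 ss0 sp]]] := exists_restriction np.
rewrite -es0 -et0.
under eq_bigr do under eq_bigr do
  rewrite (inj_eq (@shift_inj _)) !val_eqE -mulnb natrM.
under eq_bigr do rewrite -mulr_sumr.
rewrite -mulr_suml.
have sum1 (C : {fset perm_word}) c : \sum_(r <- C)
  ((c == r)%:R : K) = (c \in C)%:R.
  rewrite -natr_sum; congr (_%:R); rewrite -(count_uniq_mem c (fset_uniq C)).
  by rewrite -sum1_count [RHS]big_mkcond; apply: eq_bigr => r _ /=;
    rewrite eq_sym; case: eqP.
rewrite !sum1 -natrM mulnb inA inB; congr ((nat_of_bool _)%:R).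
apply/andP/asboolP => [[/asboolP h1 /asboolP h2]|].
  by apply/(perm_le_over t es0 et0 ss0 sp).
by move/(perm_le_over t es0 et0 ss0 sp) => [h1 h2]; split; apply/asboolP.
Qed.

(** * Monomials in the generators *)

Definition generator := {J : TBT | nonempty_connected J}.

Lemma exists_generator_perm (J : generator) :
  exists s, [/\ reduced s, atom s & symbol s = val J].
Proof.
case: J => J /= /andP[J0 /asboolP[s [bs es cs]]].
have [t [irt et]] := exists_reduced s.
exists t; split=> //; last by apply: val_inj; rewrite /= et.
split; last exact/(connected_class irt bs et).
by rewrite -nodes_Psymbol et es.
Qed.

Definition gen_perm (J : generator) : perm_word :=
  sval (cid (exists_generator_perm J)).

Lemma gen_permP (J : generator) : [/\ reduced (gen_perm J), atom (gen_perm J)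
  & symbol (gen_perm J) = val J].
Proof. by rewrite /gen_perm; case: cid. Qed.

Lemma gen_perm_inj : injective gen_perm.
Proof.
move=> J1 J2 e; apply: val_inj.
have [_ _ <-] := gen_permP J1; have [_ _ <-] := gen_permP J2.
by rewrite e.
Qed.

Lemma gen_perm_surj s : reduced s -> atom s ->
  exists J : generator, gen_perm J = s.
Proof.
move=> irs [s0 cs].
have ncs : nonempty_connected (symbol s).
  apply/andP; split; first by rewrite /TBT_size /= nodes_Psymbol.
  apply/asboolP; have [b [bb eb]] := exists_baxter s.
  by exists b; split=> //; apply/(connected_class irs bb (esym eb)).
exists (exist _ (symbol s) ncs); have [irg _ eg] :=
  gen_permP (exist _ (symbol s) ncs).
by apply: reduced_class_inj => //; apply: (congr1 trees eg).
Qed.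

Definition mon_perm (m : {fmonom generator}) : perm_word :=
  overs (map gen_perm m).

Lemma mon_perm_reduced m : reduced (mon_perm m).
Proof.
by apply/reduced_overs => t /mapP[J _ ->]; case: (gen_permP J).
Qed.

Lemma mon_perm_inj : injective mon_perm.
Proof.
have at_ (m : {fmonom generator}) t : t \in map gen_perm m -> atom t.
  by case/mapP=> J _ ->; case: (gen_permP J).
move=> m1 m2 /(overs_inj (@at_ m1) (@at_ m2)) /(inj_map gen_perm_inj).
exact: val_inj.
Qed.

Lemma mon_perm_surj s : reduced s -> exists m, mon_perm m = s.
Proof.
have [l [al <-]] := exists_atoms s; move/reduced_overs => irl.
suff [js ejs] : exists js, map gen_perm js = l.
  by exists (FMonom js); rewrite /mon_perm ejs.
elim: l al irl => [|t l IHl] al irl; first by exists [::].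
have [|J eJ] := gen_perm_surj (irl t (mem_head _ _)); first exact/al/mem_head.
have [||js ejs] := IHl; last by exists (J :: js); rewrite /= eJ ejs.
  by move=> r rl; apply: al; rewrite inE rl orbT.
by move=> r rl; apply: irl; rewrite inE rl orbT.
Qed.

Lemma prod_basisE (m : {fmonom generator}) :
  \prod_(J <- (m : seq generator)) basisE K (val J) = upper_sum (mon_perm m).
Proof.
rewrite /mon_perm; elim: (fmonom_val m) => [|J l IHl].
  by rewrite big_nil upper_sum_empty.
rewrite big_cons IHl /= -upper_sum_mul; congr (_ * _).
by have [irg _ <-] := gen_permP J; apply: basisE_upper_sum.
Qed.

(** * Freeness *)

Notation eval := (free_eval (fun J : generator => basisE K (val J))).

Lemma evalE f : eval f = \sum_(m <- msupp f) f@_m *: upper_sum (mon_perm m).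
Proof.
rewrite /free_eval linextE; apply: eq_bigr => m _.
by rewrite prod_basisE.
Qed.

(** If [m] is a monomial of [f] whose permutation has the fewest inversions,
    then this permutation is in the upper set of no other monomial of [f], so
    that the coefficient of [m] in [f] is visible in the image. *)
Lemma free_eval_inj : injective eval.
Proof.
move=> f g /eqP; rewrite -subr_eq0 -linearB /= => /eqP;
  move: (f - g) (subr0_eq (x := f) (y := g)).
move=> h fg h0; apply: fg; apply/eqP; rewrite -msupp_eq0; apply/negPn/negP.
move=> /fset0Pn[m0 m0h].
have ex : exists n, [exists m : msupp h, inversions (mon_perm (val m)) == n].
  by exists (inversions (mon_perm m0)); apply/existsP; exists [` m0h]%fset.
case: (ex_minnP ex) => n /existsP[[m mh] /= /eqP mn] nmin.
have : (eval h)@_(mon_perm m) = 0 by rewrite h0 mcoeff0.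
rewrite evalE (raddf_sum (mcoeff (mon_perm m))) /= (big_fsetD1 m) //=.
rewrite big1_seq => [|m' /andP[_]].
  rewrite addr0 mcoeffZ mcoeff_upper_sum (asboolT (rt_refl _ _ _)) mulr1 =>
    /eqP.
  by rewrite mcoeff_eq0 mh.
rewrite !inE => /andP[nm m'h]; rewrite mcoeffZ mcoeff_upper_sum.
case: asboolP => [/perm_leP[sz le]|]; last by rewrite mulr0.
have : (inversions (mon_perm m') < n)%N.
  rewrite -mn; apply: inversions_lt => // /val_inj /mon_perm_inj e.
  by rewrite e eqxx in nm.
rewrite ltnNge nmin //; apply/existsP.
by exists [` m'h]%fset => /=.
Qed.

Lemma range_eval_lin c (f g : FQSym K) :
  range eval f -> range eval g -> range eval (c *: f + g).
Proof.
by case=> f' _ <- [g' _ <-]; exists (c *: f' + g') => //; rewrite linearP.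
Qed.

Lemma range_eval0 : range eval 0.
Proof. by exists 0 => //; rewrite linear0. Qed.

Lemma range_eval_sum (T : eqType) (r : seq T) (c : T -> K) (F : T -> FQSym K) :
  (forall i, i \in r -> range eval (F i)) ->
  range eval (\sum_(i <- r) c i *: F i).
Proof.
elim: r => [|i r IHr] H; first by rewrite big_nil; apply: range_eval0.
rewrite big_cons; apply: range_eval_lin; first exact/H/mem_head.
by apply: IHr => j jr; apply: H; rewrite inE jr orbT.
Qed.

Lemma range_basisE s : reduced s -> range eval (basisE K (symbol s)).
Proof.
move=> irs; have [m em] := mon_perm_surj irs.
exists << m >> => //; rewrite basisE_upper_sum // -em -prod_basisE.
by rewrite /free_eval linextU.
Qed.

(** Induction from the largest number of inversions down: [basisE] at a class
    is [basisP] at the same class plus terms [basisP] at classes whose reduced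
    permutation has more inversions. *)
Lemma range_basisP J : range eval (basisP K J).
Proof.
have [[s0 es0]|no] := pselect (exists s, symbol s = J); last first.
  suff -> : basisP K J = 0 by apply: range_eval0.
  apply/malgP => t; rewrite mcoeff_basisP mcoeff0; case: eqP => // e.
  by case: no; exists t.
have [s [irs es]] := exists_reduced s0.
have {s0 es0 es} <- : symbol s = J by rewrite -es0; apply: val_inj.
have inversions_max t : (inversions t <= (size t).+1 * (size t).+1)%N.
  by rewrite /inversions (leq_trans (max_card _)) // card_prod card_ord.
have [n] := ubnP ((size s).+1 * (size s).+1 - inversions s)%N.
elim: n s irs => // n IHn s irs; rewrite ltnS => le_n.
pose A := [set J' : TBT | baxter_le (symbol s) J'].
have fA : finite_set A by exact: finite_baxter_le.
have As : A (symbol s) by apply/(baxter_le_reduced _ irs); apply: rt_refl.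
have e : basisE K (symbol s) =
    basisP K (symbol s) + \sum_(J' \in A `\ symbol s) basisP K J'.
  by rewrite /basisE (fsbigD1 (symbol s)).
have -> : basisP K (symbol s) =
    (-1) *: (\sum_(J' \in A `\ symbol s) basisP K J') + basisE K (symbol s).
  by rewrite e scaleN1r addrC addrK.
apply: range_eval_lin; last exact: range_basisE.
rewrite fsbig_finite; last exact: finite_setD.
under eq_bigr do rewrite -[basisP _ _]scale1r.
apply: range_eval_sum => J'; rewrite in_fset_set; last exact: finite_setD.
rewrite inE => -[[s1 [t1 [es1 et1 le1]]] /= nJ].
have [t [irt et]] := exists_reduced t1.
have eJ : symbol t = J' by apply: val_inj; rewrite /= et et1.
have st : perm_le s t by apply: reduced_le_class irs es1 le1 _; rewrite et.
have [szst lest] : size s = size t /\ inv_le s t by apply/perm_leP.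
rewrite -eJ; apply: IHn => //; rewrite -szst.
have lt_st : (inversions s < inversions t)%N.
  by apply: inversions_lt => // /val_inj ste; apply: nJ; rewrite -eJ ste.
apply: leq_trans le_n; rewrite ltn_sub2l //.
by apply: leq_trans lt_st _; rewrite szst.
Qed.

Lemma range_eval : range eval = Baxter K.
Proof.
apply/seteqP; split=> [x [f _ <-]|x [f _ <-]]; last first.
  by rewrite linextE; apply: range_eval_sum => J _; apply: range_basisP.
have hE J : exists g, linext (basisP K) g = basisE K J.
  exists (\sum_(J' <- fset_set [set J' | baxter_le J J']) << J' >>).
  rewrite linear_sum /basisE fsbig_finite; last exact: finite_baxter_le.
  by apply: eq_bigr => J' _; rewrite /= linextU.
exists (\sum_(m <- msupp f) f@_m *: sval (cid (hE (symbol (mon_perm m))))) =>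
  //.
rewrite evalE linear_sum; apply: eq_bigr => m _; rewrite linearZ /=.
by case: cid => g /= ->; rewrite basisE_upper_sum //; apply: mon_perm_reduced.
Qed.

End Algebra.

Theorem proposition6p6 (K : fieldType) (char0 : [pchar K] =i pred0) :
  freely_generates
    (fun J : {J : TBT | nonempty_connected J} => basisE K (val J))
    (Baxter K).
Proof. by split; [apply: free_eval_inj | apply: range_eval]. Qed.
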